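(* There exist uncountably many RGD systems of universal type which are not linearizable.
   Context: **Roots as half-spaces.** Let $(W,S)$ be a Coxeter system with length function $\ell$; $m_{st}$ denotes the order of $st$ in $W$. For $s\in S$ put $\alpha_s=\{w\in W\mid \ell(sw)>\ell(w)\}$. A root is a translate $w\alpha_s$ ($w\in W$, $s\in S$); $\Phi(W,S)$ is the set of roots, on which $W$ acts by left translation. A root is positive if it contains $1_W$, and negative otherwise; $\Phi(W,S)_{\pm}$ are the sets of positive/negative roots. For a root $\alpha$ put $-\alpha:=W\setminus\alpha\in\Phi(W,S)$. A pair $\{\alpha,\beta\}\subseteq\Phi(W,S)$ is prenilpotent if there are $w,w'\in W$ with $\{w\alpha,w\beta\}\subseteq\Phi(W,S)_+$ and $\{w'\alpha,w'\beta\}\subseteq\Phi(W,S)_-$. In this case $[\alpha,\beta]$ is the set of all $\gamma\in\Phi(W,S)$ such that for all $w\in W$ and $\epsilon\in\{+,-\}$: $\{w\alpha,w\beta\}\subseteq\Phi(W,S)_\epsilon$ implies $w\gamma\in\Phi(W,S)_\epsilon$; and $(\alpha,\beta):=[\alpha,\beta]\setminus\{\alpha,\beta\}$. $(W,S)$ is of universal type if $m_{st}=\infty$ for all distinct $s,t\in S$; an RGD system is of universal type if it is of type $(W,S)$ for such $(W,S)$. **RGD systems.** An RGD system of type $(W,S)$ is a pair $\mathcal D=(G,(U_\alpha)_{\alpha\in\Phi(W,S)})$ of a group $G$ and subgroups $U_\alpha\le G$ (root groups) such that, with $H:=\bigcap_{\alpha}N_G(U_\alpha)$ and $U_+:=\langle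 U_\alpha\mid\alpha\in\Phi(W,S)_+\rangle$: (RGD0) $U_\alpha\ne\{1\}$ for all $\alpha$; (RGD1) $[U_\alpha,U_\beta]\le\langle U_\gamma\mid\gamma\in(\alpha,\beta)\rangle$ for every prenilpotent pair $\{\alpha,\beta\}$ with $\alpha\neq\beta$; (RGD2) for every $s\in S$ and $1\ne u\in U_{\alpha_s}$ there exist $u',u''\in U_{-\alpha_s}$ such that $u'uu''$ conjugates $U_\beta$ onto $U_{s\beta}$ for each root $\beta$; (RGD3) $U_{-\alpha_s}\not\le U_+$ for every $s\in S$; (RGD4) $G=H\langle U_\alpha\mid\alpha\in\Phi(W,S)\rangle$. **Root bases.** A root basis is a tuple $\mathcal B=(V,\Pi,\Pi^\vee=\{\alpha^\vee\mid\alpha\in\Pi\})$ with $V$ a real vector space, $\emptyset\ne\Pi\subseteq V$, $\Pi^\vee\subseteq V^*$ such that, with $\langle\alpha,f\rangle:=f(\alpha)$ for $\alpha\in V$, $f\in V^*$: (RB1) $\langle\alpha,\alpha^\vee\rangle=2$ for all $\alpha\in\Pi$; (RB2) for distinct $\alpha,\beta\in\Pi$ either $\langle\alpha,\beta^\vee\rangle=0=\langle\beta,\alpha^\vee\rangle$, or both are $<0$ and $\langle\alpha,\beta^\vee\rangle\langle\beta,\alpha^\vee\rangle\in\{4\cos^2(\pi/k)\mid k\in\mathbb N, k\ge1\}\cup\mathbb R_{\ge4}$; (RB3) there is $f\in V^*$ with $\langle\alpha,f\rangle>0$ for all $\alpha\in\Pi$. For $\alpha\in\Pi$ let $r_\alpha(v)=v-\langle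 v,\alpha^\vee\rangle\alpha$; put $S(\mathcal B)=\{r_\alpha\mid\alpha\in\Pi\}$ and $W(\mathcal B)=\langle S(\mathcal B)\rangle\le\mathrm{GL}(V)$ (then $(W(\mathcal B),S(\mathcal B))$ is a Coxeter system), $\Phi(\mathcal B)=\{w(\alpha)\mid w\in W(\mathcal B),\alpha\in\Pi\}$, $\Phi(\mathcal B)_+=\Phi(\mathcal B)\cap\sum_{\alpha\in\Pi}\mathbb R_{\ge0}\alpha$. $\mathcal B$ is reduced if $\Phi(\mathcal B)\cap\mathbb R\alpha=\{\alpha,-\alpha\}$ for all $\alpha\in\Pi$. $\mathcal B$ is associated with $(W,S)$ if there is a bijection $S\to S(\mathcal B)$ extending to an isomorphism $W\to W(\mathcal B)$; then $W$ is identified with $W(\mathcal B)$. If $\mathcal B$ is reduced and associated with $(W,S)$, then $\Phi(\mathcal B)\to\Phi(W,S)$, $\alpha\mapsto\{w\in W\mid w^{-1}(\alpha)\in\Phi(\mathcal B)_+\}$ is a $W$-equivariant bijection; let $\varphi\colon\Phi(W,S)\to\Phi(\mathcal B)$ be its inverse. **Linearity.** For such $\mathcal B$ and a prenilpotent pair $\{\alpha,\beta\}$ put $[\alpha,\beta]^{\mathcal B}_{\mathrm{lin}}:=\{\gamma\in\Phi(W,S)\mid\varphi(\gamma)\in\mathbb R_{\ge0}\varphi(\alpha)+\mathbb R_{\ge0}\varphi(\beta)\}$ and $(\alpha,\beta)^{\mathcal B}_{\mathrm{lin}}:=[\alpha,\beta]^{\mathcal B}_{\mathrm{lin}}\setminus\{\alpha,\beta\}$.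 $\mathcal D$ is linear w.r.t. $\mathcal B$ if $[U_\alpha,U_\beta]\le\langle U_\gamma\mid\gamma\in(\alpha,\beta)^{\mathcal B}_{\mathrm{lin}}\rangle$ for every prenilpotent pair $\{\alpha,\beta\}$ with $\alpha\ne\beta$. $\mathcal D$ is linearizable if there is a reduced root basis $\mathcal B$ associated with $(W,S)$ such that $\mathcal D$ is linear w.r.t. $\mathcal B$. *)

(* Defs.v *)
From HB Require Import structures.
From mathcomp Require Import all_boot all_order all_algebra.
From mathcomp Require Import boolp classical_sets functions cardinality reals trigo.

Set Implicit Arguments.
Unset Strict Implicit.
Unset Printing Implicit Defensive.

Local Open Scope classical_set_scope.
Local Open Scope group_scope.

Section Subgroups.
Context {G : groupType}.
Implicit Types A B U : set G.

Definition is_subgroup A :=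
  [/\ A 1, forall x y, A x -> A y -> A (x * y) & forall x, A x -> A x^-1].

Definition gen A : set G := smallest is_subgroup A.

Definition commutator A B : set G := gen [set [~ a, b] | a in A & b in B].

Definition conj_set (g : G) U : set G := [set g * x * g^-1 | x in U].

Definition normalizer U : set G := [set g | conj_set g U = U].

End Subgroups.

Definition is_hom {G K : groupType} (f : G -> K) := {morph f : x y / x * y}.

Section Coxeter.
Context {W : groupType}.
Variable S : set W.

(* The third clause is the universal property of the presentation
   < S | (s t) ^ m_st = 1 for s, t in S with m_st finite >; the relation
   (s t) ^ n = 1 holds in W exactly when m_st is finite and divides n. *)
Definition coxeter_system :=
  [/\ forall s, S s -> s != 1 /\ s * s = 1,
      gen S = [set: W] &
      forall (K : groupType) (f : W -> K),
        (forall s t n, S s -> S t -> (s * t) ^+ n = 1 -> (f s * f t) ^+ n = 1) ->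
        exists2 h : W -> K, is_hom h & forall s, S s -> h s = f s].

Definition universal_type :=
  forall s t, S s -> S t -> s != t -> forall n, (s * t) ^+ n = 1 -> n = 0%N.

Definition has_word (w : W) (n : nat) :=
  exists l : seq W,
    [/\ size l = n, forall s, s \in l -> S s & w = \prod_(s <- l) s].

Definition cox_length (w : W) : nat :=
  xget 0%N [set n | has_word w n /\ forall m, has_word w m -> (n <= m)%N].

Definition simple_root (s : W) : set W :=
  [set w | (cox_length w < cox_length (s * w))%N].

Definition translate (w : W) (a : set W) : set W := [set w * x | x in a].

Definition cox_roots : set (set W) :=
  [set a | exists w s, S s /\ a = translate w (simple_root s)].

Definition pos_roots : set (set W) := [set a | cox_roots a /\ a 1].
Definition neg_roots : set (set W) := [set a | cox_roots a /\ ~ a 1].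

Definition prenilpotent (a b : set W) :=
  [/\ cox_roots a, cox_roots b,
      exists w, pos_roots (translate w a) /\ pos_roots (translate w b) &
      exists w, neg_roots (translate w a) /\ neg_roots (translate w b)].

Definition closed_interval (a b : set W) : set (set W) :=
  [set c | cox_roots c /\ forall w,
     (pos_roots (translate w a) -> pos_roots (translate w b) ->
      pos_roots (translate w c)) /\
     (neg_roots (translate w a) -> neg_roots (translate w b) ->
      neg_roots (translate w c))].

Definition open_interval (a b : set W) : set (set W) :=
  closed_interval a b `\` [set a; b].

End Coxeter.

Section RGD.
Context {W : groupType} (S : set W) {G : groupType}.
(* Only the values of U on cox_roots S are meaningful. *)
Variable U : set W -> set G.

Definition root_gen (A : set (set W)) : set G := gen (\bigcup_(a in A) U a).

Definition torus : set G := \bigcap_(a in cox_roots S) normalizer (U a).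

Definition is_rgd :=
  [/\ forall a, cox_roots S a -> is_subgroup (U a) /\ U a <> [set 1],
      forall a b, prenilpotent S a b -> a <> b ->
        commutator (U a) (U b) `<=` root_gen (open_interval S a b),
      forall s u, S s -> U (simple_root S s) u -> u <> 1 ->
        exists u' u'', [/\ U (~` simple_root S s) u',
          U (~` simple_root S s) u'' &
          forall b, cox_roots S b ->
            conj_set (u' * u * u'') (U b) = U (translate s b)],
      forall s, S s ->
        ~ (U (~` simple_root S s) `<=` root_gen (pos_roots S)) &
      forall g, exists h x,
        [/\ torus h, root_gen (cox_roots S) x & g = h * x]].

End RGD.

Record rgd_system := RGDSystem {
  rgd_W : groupType;
  rgd_S : set rgd_W;
  rgd_cox : coxeter_system rgd_S;
  rgd_G : groupType;
  rgd_U : set rgd_W -> set rgd_G;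
  rgd_axioms : is_rgd rgd_S rgd_U }.

Arguments rgd_S : clear implicits.
Arguments rgd_U : clear implicits.

Definition rgd_isomorphic (D D' : rgd_system) :=
  exists (p : rgd_W D -> rgd_W D') (h : rgd_G D -> rgd_G D'),
    [/\ is_hom p /\ bijective p,
        p @` rgd_S D = rgd_S D',
        is_hom h /\ bijective h &
        forall a, cox_roots (rgd_S D) a -> h @` rgd_U D a = rgd_U D' (p @` a)].

Section RootBases.
Variable R : realType.
Local Open Scope ring_scope.

(* Only the values of coroot on simples are meaningful. *)
Record root_basis := RootBasis {
  rb_V : lmodType R;
  simples : set rb_V;
  coroot : rb_V -> {scalar rb_V};
  rb_nonempty : simples !=set0;
  rb_two : forall a, simples a -> coroot a a = 2;
  rb_pairing : forall a b, simples a -> simples b -> a != b ->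
    (coroot b a = 0 /\ coroot a b = 0) \/
    [/\ coroot b a < 0, coroot a b < 0 &
        (exists2 k : nat, (1 <= k)%N &
           coroot b a * coroot a b = 4 * cos (pi / k%:R) ^+ 2) \/
        4 <= coroot b a * coroot a b];
  rb_positive : exists f : {scalar rb_V}, forall a, simples a -> 0 < f a }.

Arguments simples : clear implicits.

Section Basis.
Variable B : root_basis.
Local Notation V := (rb_V B).

Definition reflection (a v : V) : V := v - coroot a v *: a.

Definition reflections : set (V -> V) := [set reflection a | a in simples B].

Definition transf_group (F : set (V -> V)) :=
  [/\ F id, forall f g, F f -> F g -> F (f \o g) &
      forall f g, F f -> cancel f g -> cancel g f -> F g].

(* The subgroup of Sym(V), hence of GL(V), generated by the reflections. *)
Definition weyl : set (V -> V) := smallest transf_group reflections.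

Definition rb_roots : set V :=
  [set v | exists w a, [/\ weyl w, simples B a & v = w a]].

Definition nonneg_span : set V :=
  [set v | exists n (c : 'I_n -> R) (a : 'I_n -> V),
     (forall i, 0 <= c i /\ simples B (a i)) /\ v = \sum_(i < n) c i *: a i].

Definition rb_pos_roots : set V := rb_roots `&` nonneg_span.

Definition reduced :=
  forall a, simples B a ->
    rb_roots `&` [set c *: a | c in [set: R]] = [set a; - a].

Section Identification.
Context {W : groupType} (S : set W).
Variable rho : W -> V -> V.

(* rho is an isomorphism from W onto weyl which maps S onto reflections. *)
Definition identification :=
  [/\ forall x y, rho (x * y)%g = rho x \o rho y,
      injective rho, range rho = weyl & rho @` S = reflections].

Definition half_space (v : V) : set W := [set w | rb_pos_roots (rho w^-1%g v)].

(* The inverse of half_space : rb_roots -> cox_roots S. *)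
Definition root_vector (c : set W) : V :=
  xget 0 [set v | rb_roots v /\ half_space v = c].

Definition lin_closed_interval (a b : set W) : set (set W) :=
  [set c | cox_roots S c /\ exists x y : R, [/\ 0 <= x, 0 <= y &
     root_vector c = x *: root_vector a + y *: root_vector b]].

Definition lin_open_interval (a b : set W) : set (set W) :=
  lin_closed_interval a b `\` [set a; b].

End Identification.

Definition linear_wrt (D : rgd_system) (rho : rgd_W D -> V -> V) :=
  forall a b, prenilpotent (rgd_S D) a b -> a <> b ->
    commutator (rgd_U D a) (rgd_U D b) `<=`
      root_gen (rgd_U D) (lin_open_interval (rgd_S D) rho a b).

End Basis.

(* If S is empty, then no root basis is associated with (W, S), as root bases
   have a simple root, so that D is not linearizable for a trivial reason. *)
Definition linearizable (D : rgd_system) :=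
  exists (B : root_basis) (rho : rgd_W D -> rb_V B -> rb_V B),
    [/\ reduced B, identification (rgd_S D) rho & linear_wrt rho].

End RootBases.

(* Main.v *)
(** The Coxeter group W is a free product of groups of order two, so its Cayley
    graph is a tree, its roots are the half-trees, and two distinct roots form a
    prenilpotent pair exactly when they are nested.  Fix distinct letters s, t, u.
    A group G generated by one copy of Sym(3) per letter acts on the chambers of
    the tree building with three chambers in each panel, in such a way that the
    root groups have order two and that, up to translation by W, the only
    nontrivial commutator is the one of U_(alpha_s) and U_(s t alpha_u), which is
    the generator of U_(s alpha_t).  The positive root groups fix a base chamber
    that no U_(-alpha_r) fixes, whence (RGD3).  In any root basis, the vector
    s(a_t) of s alpha_t lies outside the cone spanned by the vectors a_s and
    s t(a_u), so that the linear interval of this pair is empty and the system is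
    not linearizable.

    To obtain uncountably many systems, multiply G by the localization
    Z[1/p : p in P] for a set of primes P.  This factor lies in the torus, and the
    quotient of the product by the root groups is p-divisible exactly for p in P. *)
Require Import Defs.
From HB Require Import structures.
From mathcomp Require Import all_boot all_order all_algebra.
From mathcomp Require Import boolp classical_sets functions cardinality reals trigo.
From mathcomp Require Import ring lra.

Set Implicit Arguments.
Unset Strict Implicit.
Unset Printing Implicit Defensive.

Import Order.TTheory GRing.Theory Num.Theory.
Local Open Scope classical_set_scope.

(** * Root elements acting on the chambers of a tree *)

Section TreeAction.
Variables (A : eqType) (s t u : A).
Hypotheses (st : s != t) (tu : t != u) (su : s != u).

(* For g ending in s and v = tu, the root elements of g and g ++ v do not
   commute: their commutator is the root element of rcons g t. *)
Definition stu_split (g v : seq A) := (last t g == s) && (v == [:: t; u]).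

(* A chamber is a word whose letter r carries a bit, to be read as a gallery from
   the base chamber: next to the current chamber, its r-panel contains two others,
   labelled (r, false) and (r, true).  A positive root is a nonempty word g, and
   [act_rec n g] is the action of its root element on words of length at most n.
   An r-panel cuts the tree into three isomorphic pieces.  The element u_r of
   the word [:: r] exchanges the last two, and n_r, defined below as [refl_act],
   exchanges the first two, so the value on (r, false) :: x is that of n_r g n_r on x.
   On (r, true) :: x it is forced by the required commutator with u_r: it is
   [twist], conjugated by u_r unless r is the first letter of g. *)
Fixpoint act_rec n (g : seq A) (x : seq (A * bool)) : seq (A * bool) :=
  match n, g, x with
  | n'.+1, r' :: g', (r, e) :: x' =>
    let twist d y := act_rec n' d (if stu_split [:: r] d then act_rec n' [:: t] y else y) in
    if r == r' then
      if g' is [::] then (r, ~~ e) :: x'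
      else (r, e) :: if e then twist g' x' else act_rec n' g' x'
    else (r, e) ::
      if e then act_rec n' [:: r] (twist g (act_rec n' [:: r] x'))
      else act_rec n' (r :: g) x'
  | _, _, _ => x
  end.

Definition twist n r d y :=
  act_rec n d (if stu_split [:: r] d then act_rec n [:: t] y else y).

Lemma act_recE n q g r e x : act_rec n.+1 (q :: g) ((r, e) :: x) =
  if r == q then
    if g is [::] then (r, ~~ e) :: x
    else (r, e) :: if e then twist n r g x else act_rec n g x
  else (r, e) ::
    if e then act_rec n [:: r] (twist n r (q :: g) (act_rec n [:: r] x))
    else act_rec n [:: r, q & g] x.
Proof. by []. Qed.

Arguments act_rec : simpl never.

Lemma act_rec_nil n g : act_rec n g [::] = [::].
Proof. by case: n g => [|n] []. Qed.

Lemma act_rec_one n x : act_rec n [::] x = x.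
Proof. by case: n. Qed.

Lemma stu_split_cons r g v : g != [::] -> stu_split (r :: g) v = stu_split g v.
Proof. by case: g. Qed.

Lemma act_rec_unzip n g x : unzip1 (act_rec n g x) = unzip1 x.
Proof.
elim: n g x => [|n IHn] [|q g] [|[r e] x] //.
have tE d y : unzip1 (twist n r d y) = unzip1 y by rewrite /twist IHn; case: ifP; rewrite ?IHn.
rewrite act_recE; case: eqP => _; last by case: e => /=; rewrite IHn ?tE ?IHn.
by case: g => [//|q' g]; case: e => /=; rewrite ?tE ?IHn.
Qed.

Let invol n := forall g x, act_rec n g (act_rec n g x) = x.
(** Commutator relation of two nested positive roots. Writing u_g for the action of [g], an
    involution, it reads u_g u_(gv) u_g = u_(gv) times the prescribed commutator. *)
Let nested n := forall g v x, g != [::] -> v != [::] ->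
  act_rec n g (act_rec n (g ++ v) (act_rec n g x)) =
  act_rec n (g ++ v) (if stu_split g v then act_rec n (rcons g t) x else x).

Lemma stu_split_t v : stu_split [:: t] v = false.
Proof. by rewrite /stu_split /= eq_sym (negPf st). Qed.

Lemma stu_split_tu v : stu_split [:: t; u] v = false.
Proof. by rewrite /stu_split /= eq_sym (negPf su). Qed.

Lemma stu_split1 r d : stu_split [:: r] d = (r == s) && (d == [:: t; u]).
Proof. by []. Qed.

Lemma nested_t n v x : nested n -> v != [::] ->
  act_rec n [:: t] (act_rec n (t :: v) (act_rec n [:: t] x)) = act_rec n (t :: v) x.
Proof. by move=> N v0; rewrite (N [:: t] v) ?stu_split_t. Qed.

(** The twist is u_d, or u_d u_t with d = tu; in the second case the factors are commuting
    involutions, since [[:: t]] does not end in s. *)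
Lemma twist_invol n r d x : invol n -> nested n -> twist n r d (twist n r d x) = x.
Proof.
move=> I N; rewrite /twist; case: (boolP (stu_split _ _)) => [|_]; last by rewrite I.
by rewrite stu_split1 => /andP[_ /eqP->]; rewrite nested_t ?I.
Qed.

(** The extra factor u_t appears only if [g] or [g ++ v] is the word tu. All words in the relation
    then begin with t, so u_t commutes with their root elements. *)
Lemma twist_nested n r g v x : invol n -> nested n -> g != [::] -> v != [::] ->
  twist n r g (twist n r (g ++ v) (twist n r g x)) =
  twist n r (g ++ v) (if stu_split g v then twist n r (rcons g t) x else x).
Proof.
move=> I N g0 v0.
have C y : act_rec n [:: t] (act_rec n [:: t; u] y) =
    act_rec n [:: t; u] (act_rec n [:: t] y).
  by rewrite -{1}[y](I [:: t]) nested_t.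
have ntw : stu_split [:: r] (rcons g t) = false.
  rewrite stu_split1; apply/negP => /andP[_ /eqP/(congr1 (last t))].
  by rewrite last_rcons /= => /eqP; rewrite (negPf tu).
rewrite /twist ntw; case: (boolP (stu_split [:: r] g)) => [|_].
  rewrite stu_split1 => /andP[_ /eqP gE]; rewrite {}gE {g g0 ntw} in C *.
  have -> : stu_split [:: r] ([:: t; u] ++ v) = false.
    by case: v v0 => // a v _; rewrite stu_split1 !eqseq_cons !andbF.
  rewrite stu_split_tu.
  by rewrite -(C x) nested_t ?N ?stu_split_tu.
case: (boolP (stu_split [:: r] (g ++ v))) => [|_]; last by rewrite N.
rewrite stu_split1 => /andP[_ /eqP gE].
have [-> ->] : g = [:: t] /\ v = [:: u].
  by case: g v g0 v0 gE {N ntw} => [|a [|b [|c g]]] [|d [|e v]] //= _ _ [-> -> ].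
by rewrite stu_split_t I C.
Qed.

(** A joint induction on the length bound: that the twist is an involution relies on the nested
    relations for the previous bound. *)
Lemma act_rec_rel n : invol n /\ nested n.
Proof.
elim: n => [|n [I N]].
  by split=> [[|q g] x //|g v x]; case: ifP => _; case: g v => [|? ?] [].
have TI r d x : twist n r d (twist n r d x) = x by exact: twist_invol.
have TN := twist_nested _ _ I N.
split=> [[|q g] [|[r e] x]//|[|q g] v [|[r e] x] // _ v0]; last 2 first.
- by rewrite !act_rec_nil; case: ifP => _; rewrite !act_rec_nil.
- have [<-{q}|rq] := eqVneq r q.
    case: g => [|q g].
      (* The root element of [[:: r]] only flips the bit, so the relation exchanges the plain and
         the twisted branch. They differ by u_t, which is how u_(rt) acts one letter deeper. *)
      case: v v0 => [//|q v _].
      have tt d : twist n r [:: t] d = act_rec n [:: t] d.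
        by rewrite /twist stu_split1 eqseq_cons andbF andbF.
      have tv y : twist n r (q :: v) y = act_rec n (q :: v)
        (if stu_split [:: r] (q :: v) then act_rec n [:: t] y else y) by [].
      rewrite !cat_cons !cat0s rcons_cons /=.
      rewrite [act_rec n.+1 [:: r] ((r, e) :: x)]act_recE eqxx act_recE eqxx act_recE eqxx negbK.
      case: (stu_split [:: r] (q :: v)) tv => tv; rewrite !act_recE eqxx.
        by case: e => /=; rewrite !act_recE eqxx ?tv ?tt ?I.
      by case: e => /=; rewrite ?act_recE ?eqxx ?tv.
    (* The panel letter is the common first letter: the relation is that of the tails, plain or
       twisted according to the bit. *)
    have := TN r (q :: g) v x isT v0; have := N (q :: g) v x isT v0.
    rewrite (@stu_split_cons r (q :: g) v isT); case: (stu_split (q :: g) v) => Nx Tx;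
      rewrite ?rcons_cons !cat_cons !(act_recE, eqxx); case: e.
    + by congr cons.
    + by congr cons.
    + by congr cons.
    + by congr cons.
  (* At a panel of another letter r, the bit selects between the twisted relation conjugated by u_r
     and the relation for the words prefixed by r. *)
  have := TN r (q :: g) v (act_rec n [:: r] x) isT v0; have := N [:: r, q & g] v x isT v0.
  rewrite (@stu_split_cons r (q :: g) v isT); case: (stu_split (q :: g) v) => Nx Tx;
    rewrite ?rcons_cons !cat_cons !(act_recE, negPf rq); case: e.
  + by rewrite !I -Tx.
  + by congr cons.
  + by rewrite !I -Tx.
  + by congr cons.
have [<-{q}|rq] := eqVneq r q.
  case: g => [|q g]; rewrite !(act_recE, eqxx) ?negbK //.
  by case: e; rewrite ?TI ?I.
by rewrite !(act_recE, negPf rq); case: e; rewrite ?I ?TI ?I.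
Qed.

End TreeAction.
Arguments act_rec {A} s t u n g x : simpl never.

(** * The universal Coxeter group *)

Local Open Scope group_scope.

Lemma gen_is_subgroup (G : groupType) (X : set G) : is_subgroup (gen X).
Proof.
split=> [B [[]]|x y gx gy B sB|x gx B sB] //; case: (sB) => -[_ sM sV] _.
  by apply: sM; [apply: gx|apply: gy].
by apply: sV; apply: gx.
Qed.

Section Words.
Variable A : choiceType.
Implicit Types (a b : A) (l : seq A).

Definition reduced_word l := sorted (fun a b => a != b) l.
Arguments reduced_word : simpl never.

(** Left multiplication by a letter on normal forms. It is an involution on reduced words, so
    letters act on them, and associativity of the product comes from this action (van der Waerden's
    trick). *)
Definition cons_red a l :=
  if l is b :: l' then if b == a then l' else a :: l else [:: a].

Lemma reduced_word_cons a l : reduced_word (a :: l) = (ohead l != Some a) && reduced_word l.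
Proof. by rewrite /reduced_word; case: l => //= b l; rewrite eq_sym. Qed.

Lemma cons_red_alt a l : reduced_word (a :: l) -> cons_red a l = a :: l.
Proof. by case: l => //= b l; rewrite reduced_word_cons => /andP[/= ba _]; rewrite ifN //;
  apply: contra_neq ba => ->. Qed.

Lemma reduced_word_cons_red a l : reduced_word l -> reduced_word (cons_red a l).
Proof.
case: l => // b l al; rewrite /cons_red; case: eqVneq => [_|ba].
  by move: al; rewrite reduced_word_cons => /andP[].
by rewrite reduced_word_cons al andbT; apply: contra_neq ba => -[].
Qed.

Lemma cons_redK a l : reduced_word l -> cons_red a (cons_red a l) = l.
Proof.
case: l => [|b l] /=; first by rewrite eqxx.
move=> al.
case: eqVneq => [ba|ba]; last by rewrite /= eqxx.
by rewrite cons_red_alt -?ba.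
Qed.

Lemma reduced_word_foldr l x :
  reduced_word x -> reduced_word (foldr cons_red x l).
Proof. by move=> ax; elim: l => //= a l; apply: reduced_word_cons_red. Qed.

Lemma foldr_cons_red a l x : reduced_word x ->
  foldr cons_red x (cons_red a l) = cons_red a (foldr cons_red x l).
Proof.
move=> ax; case: l => //= b l; case: eqVneq => // ->.
by rewrite cons_redK // reduced_word_foldr.
Qed.

Record word := Word { letters : seq A; lettersP : reduced_word letters }.
HB.instance Definition _ := [isSub for letters].
HB.instance Definition _ := [Choice of word by <:].

Definition wone : word := Word (isT : reduced_word [::]).
Definition wmul (v w : word) : word :=
  Word (reduced_word_foldr (letters v) (lettersP w)).

Lemma reduced_word_rev l : reduced_word l -> reduced_word (rev l).
Proof. by rewrite /reduced_word rev_sorted; congr sorted; apply/funext=> a; apply/funext=> b;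
  rewrite eq_sym. Qed.

Definition winv (w : word) : word := Word (reduced_word_rev (lettersP w)).

Lemma wmulA : associative wmul.
Proof.
move=> x y z; apply: val_inj => /=; elim: (letters x) => //= a l ->.
by rewrite foldr_cons_red ?lettersP.
Qed.

Lemma wmul1 : right_id wone wmul.
Proof.
move=> [l al]; apply: val_inj => /=; elim: l al => //= a l IHl al.
have/andP[_ al'] : (ohead l != Some a) && reduced_word l by rewrite -reduced_word_cons.
by rewrite IHl // cons_red_alt.
Qed.

Lemma wmulV : left_inverse wone winv wmul.
Proof.
have K l x : reduced_word x -> foldr cons_red (foldr cons_red x l) (rev l) = x.
  elim: l x => //= a l IHl x ax; rewrite rev_cons foldr_rcons /= cons_redK ?IHl //.
  exact: reduced_word_foldr.
move=> w; apply: val_inj => /=.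
by rewrite -{1}[letters w](congr1 val (wmul1 w)) K.
Qed.

Lemma wmulVr : right_inverse wone winv wmul.
Proof.
have winvK : involutive winv by move=> w; apply: val_inj; rewrite /= revK.
by move=> w; rewrite -{1}[w]winvK wmulV.
Qed.

Lemma wmul1l : left_id wone wmul.
Proof. by move=> w; apply: val_inj. Qed.

HB.instance Definition _ := isGroup.Build word wmulA wmul1l wmul1 wmulV wmulVr.

Definition letter a : word := @Word [:: a] isT.
Definition letter_set : set word := range letter.
Arguments letter_set : clear implicits.

Lemma letters_letterM a (w : word) : letters (letter a * w) = cons_red a (letters w).
Proof. by []. Qed.

Lemma letterK a : letter a * letter a = 1.
Proof. by apply: val_inj; rewrite /= eqxx. Qed.

Lemma letterV a : (letter a)^-1 = letter a.
Proof. by apply: mulg1_eq; apply: letterK. Qed.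

Lemma letter_inj : injective letter.
Proof. by move=> a b []. Qed.

Lemma word_ind (P : word -> Prop) : P 1 ->
  (forall a w, ohead (letters w) != Some a -> P w -> P (letter a * w)) ->
  forall w, P w.
Proof.
move=> P1 PM [l]; elim: l => [|a l IHl] al.
  by rewrite (_ : Word _ = 1) //; apply: val_inj.
have/andP[nal al'] : (ohead l != Some a) && reduced_word l by rewrite -reduced_word_cons.
rewrite (_ : Word _ = letter a * Word al'); first exact: PM.
by apply: val_inj; rewrite /= cons_red_alt.
Qed.

Section Extension.
Variables (K : groupType) (f : A -> K).
Hypothesis fK : forall a, f a * f a = 1.

Definition extend (w : word) : K := foldr (fun a x => f a * x) 1 (letters w).

Lemma extend1 : extend 1 = 1. Proof. by []. Qed.

Lemma extend_letter a : extend (letter a) = f a.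
Proof. exact: mulg1. Qed.

Lemma extend_letterM a w : extend (letter a * w) = f a * extend w.
Proof.
rewrite /extend letters_letterM; case: (letters w) => //= b l.
by case: eqVneq => [->|//]; rewrite mulgA fK mul1g.
Qed.

Lemma extendM : is_hom extend.
Proof.
move=> v w; elim/word_ind: v => [|a v _ IH]; first by rewrite !mul1g.
by rewrite -mulgA !extend_letterM IH mulgA.
Qed.

End Extension.

Lemma gen_letter_set : gen letter_set = [set: word].
Proof.
apply/seteqP; split=> // w _; have [g1 gM gV] := gen_is_subgroup letter_set.
elim/word_ind: w => // a w _ gw; apply: gM => //.
by move=> B [_]; apply; exists a.
Qed.

Lemma word_coxeter : coxeter_system letter_set.
Proof.
split=> [_ [a _ <-]||K f fS]; first by rewrite letterK.
  exact: gen_letter_set.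
(* The relation (a a)^1 = 1, a case of the hypothesis with both generators equal, is all that
   [extend] requires. *)
have fK a : f (letter a) * f (letter a) = 1.
  by have := fS (letter a) (letter a) 1%N; rewrite !expg1; apply=> //;
    [exists a|exists a|exact: letterK].
exists (extend (fun a => f (letter a))); first exact: extendM.
by move=> _ [a _ <-]; exact: extend_letter.
Qed.

(** The normal form of (a b)^n is a b repeated n times, which is empty only for n = 0. *)
Lemma word_universal : universal_type letter_set.
Proof.
move=> _ _ [a _ <-] [b _ <-] ab n.
have {}ab : a != b by apply: contraNN ab => /eqP->.
have E : letters ((letter a * letter b) ^+ n) = flatten (nseq n [:: a; b]).
  elim: n => // n IH; rewrite expgS -mulgA !letters_letterM IH.
  by case: n {IH} => [|n] /=; rewrite ?(negPf ab) /= eq_sym (negPf ab).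
by move=> /(congr1 letters); rewrite E; case: n {E}.
Qed.

Lemma size_cons_red a l : size (cons_red a l) <= (size l).+1.
Proof. by case: l => //= b l; case: eqP => //= _; rewrite leqW. Qed.

(** The normal form is itself a spelling, and each generator lengthens a normal form by at most one,
    so no spelling is shorter. *)
Lemma cox_length_word (w : word) : cox_length letter_set w = size (letters w).
Proof.
have hw : has_word letter_set w (size (letters w)).
  exists (map letter (letters w)); split; first by rewrite size_map.
    by move=> _ /mapP[a _ ->]; exists a.
  rewrite big_map; elim/word_ind: w => [|a w aw IH]; first by rewrite big_nil.
  rewrite letters_letterM cons_red_alt; last by rewrite reduced_word_cons aw lettersP.
  by rewrite big_cons -IH.
have min m : has_word letter_set w m -> size (letters w) <= m.
  case=> l [<- + ->]; elim: l => [|x l IHl] Sl; first by rewrite big_nil.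
  have [a _ <-] : letter_set x by apply: Sl; rewrite inE eqxx.
  rewrite big_cons letters_letterM (leq_trans (size_cons_red _ _)) // ltnS.
  by apply: IHl => y yl; apply: Sl; rewrite inE yl orbT.
apply: xget_unique => // n [/min wn /(_ _ hw) nw].
by apply/eqP; rewrite eqn_leq wn nw.
Qed.

Lemma simple_root_word a :
  simple_root letter_set (letter a) = [set w : word | ohead (letters w) != Some a].
Proof.
apply/funext=> w; rewrite /simple_root /= !cox_length_word letters_letterM.
congr is_true; case: (letters w) => //= b l; rewrite (inj_eq Some_inj).
by case: eqVneq => _; [rewrite ltnNge leqnSn|rewrite /= leqnn].
Qed.

Lemma reduced_word_rcons2 a b l :
  reduced_word (rcons (rcons l b) a) = reduced_word (rcons l b) && (b != a).
Proof. rewrite /reduced_word; by case: l => [|c l] //=;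
  rewrite ?andbT // rcons_path last_rcons. Qed.

Lemma foldr_cons_red_cat l l' : reduced_word (l ++ l') -> foldr cons_red l' l = l ++ l'.
Proof.
elim: l => //= a l IHl; move=> al.
by move: (al); rewrite reduced_word_cons => /andP[_ /IHl ->]; rewrite cons_red_alt.
Qed.

End Words.
Arguments letter_set : clear implicits.
Arguments reduced_word {A} l : simpl never.

(** * Roots as half-trees *)

Section Translate.
Context {W : groupType}.
Implicit Types (v w : W) (c d : set W).

Lemma translateE w c x : translate w c x = c (w^-1 * x).
Proof.
apply/propext; split=> [[y cy <-]|cx]; first by rewrite mulKg.
by exists (w^-1 * x); rewrite ?mulVKg.
Qed.

Lemma translate1 c : translate 1 c = c.
Proof. by apply/funext=> x; rewrite translateE invg1 mul1g. Qed.

Lemma translateM v w c : translate (v * w) c = translate v (translate w c).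
Proof. by apply/funext=> x; rewrite !translateE invgM mulgA. Qed.

Lemma translateC w c : translate w (~` c) = ~` translate w c.
Proof. by apply/funext=> x; rewrite /setC /mkset !translateE. Qed.

Lemma translateK w c : translate w^-1 (translate w c) = c.
Proof. by rewrite -translateM mulVg translate1. Qed.

Lemma cox_roots_translate (S : set W) w c : cox_roots S c -> cox_roots S (translate w c).
Proof. by case=> v [r [Sr ->]]; exists (w * v), r; rewrite translateM. Qed.

Lemma closed_intervalP (S : set W) a b c :
  cox_roots S c -> a `&` b `<=` c -> ~` a `&` ~` b `<=` ~` c -> closed_interval S a b c.
Proof.
move=> Sc abc Nabc; split=> // w; rewrite /pos_roots /neg_roots /= !translateE mulg1.
by split=> [[_ ?] [_ ?]|[_ ?] [_ ?]]; (split; first exact: cox_roots_translate);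
  [apply: abc|apply: Nabc].
Qed.

End Translate.

Section Halves.
Variable A : choiceType.
Implicit Types (a b : A) (l : seq A) (v w : word A).

Definition alpha a := simple_root (letter_set A) (letter a).

(** For nonempty reduced [l], the half containing 1 when the Cayley tree is cut at the last edge of
    the path from 1 to [l]. *)
Definition half_tree l : set (word A) := [set x | ~~ prefix l (letters x)].

Lemma alpha_half_tree a : alpha a = half_tree [:: a].
Proof.
rewrite /alpha simple_root_word; apply/funext=> x; rewrite /half_tree /=; congr is_true.
by case: (letters x) => //= b l; rewrite prefix0s andbT eq_sym.
Qed.

Lemma translate_half_tree a l : l != [::] -> reduced_word (a :: l) ->
  translate (letter a) (half_tree l) = half_tree (a :: l).
Proof.
move=> l0 al; apply/funext=> x; rewrite translateE letterV /half_tree /mkset letters_letterM;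
  congr (is_true (~~ _)).
case: l l0 al => // b l _; rewrite reduced_word_cons => /andP[/= ba _].
have {}ba : b != a by apply: contra_neq ba => ->.
case: (letters x) => [|d m] /=; first by rewrite (negPf ba).
by rewrite [a == d]eq_sym; case: eqVneq => //= _; rewrite (negPf ba).
Qed.

Lemma translate_alpha_pos w a : reduced_word (rcons (letters w) a) ->
  translate w (alpha a) = half_tree (rcons (letters w) a).
Proof.
elim/word_ind: w => [|b w bw IH]; first by rewrite translate1 alpha_half_tree.
rewrite letters_letterM cons_red_alt; last by rewrite reduced_word_cons bw lettersP.
rewrite rcons_cons => bwa; have := bwa; rewrite reduced_word_cons => /andP[_ wa].
by rewrite translateM IH // translate_half_tree //; case: (letters w).
Qed.

Lemma translate_alpha_self a : translate (letter a) (alpha a) = ~` alpha a.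
Proof.
apply/funext=> x; rewrite translateE letterV /alpha simple_root_word /setC /mkset letters_letterM.
apply/propext; have := lettersP x; case: (letters x) => [|b l] /=.
  by rewrite eqxx; split=> [|[]].
rewrite reduced_word_cons; case: (eqVneq b a) => [->|ba] /andP[bl _].
  by rewrite bl eqxx; split.
by rewrite eqxx; split=> // [[]]; apply: contra_neq ba => -[].
Qed.

(** The dichotomy of signs: in the first case w alpha_a is positive, in the second it is the
    complement of the positive root v alpha_a. *)
Lemma root_word_cases w a : reduced_word (rcons (letters w) a) \/
  exists v, w = v * letter a /\ reduced_word (rcons (letters v) a).
Proof.
case: w => l; case/lastP: l => [|l b] al; first by left.
have [->|ba] := eqVneq a b; last by left; rewrite /= reduced_word_rcons2 eq_sym ba andbT.
right; have al' : reduced_word l.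
  by move: al; rewrite -cats1 => /cat_sorted2[].
by exists (Word al'); split=> //; apply: val_inj; rewrite /= -cats1 foldr_cons_red_cat ?cats1.
Qed.

Lemma translate_alpha_neg v a : reduced_word (rcons (letters v) a) ->
  translate (v * letter a) (alpha a) = ~` half_tree (rcons (letters v) a).
Proof. by move=> va; rewrite translateM translate_alpha_self translateC translate_alpha_pos. Qed.

Lemma half_tree1 l : half_tree l 1 = (l != [::]).
Proof. by case: l. Qed.

(** A deeper cut leaves a larger half around 1. Conversely, the vertex [l] lies outside its own
    half-tree and tests the inclusion. *)
Lemma half_tree_subP l l' : reduced_word l ->
  reflect (half_tree l' `<=` half_tree l) (prefix l' l).
Proof.
move=> al; apply: (iffP idP) => [ll x|sub].
  by apply: contra; apply: prefix_trans.
apply/negPn/negP => ll; have /= := sub (Word al) ll.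
by rewrite /half_tree /= prefix_refl.
Qed.

Lemma half_tree_inj l l' : reduced_word l -> reduced_word l' -> half_tree l = half_tree l' ->
  l = l'.
Proof.
move=> al al' E.
have p : prefix l' l by apply/half_tree_subP; rewrite // E.
have p' : prefix l l' by apply/half_tree_subP; rewrite // E.
move: p; rewrite prefixE => /eqP <-; rewrite take_oversize // .
by rewrite prefixE in p'; rewrite -(eqP p') size_take_min geq_minr.
Qed.

Lemma rcons_neq0 (T : eqType) (l : seq T) x : rcons l x != [::].
Proof. by case: l. Qed.

(** The root determines its sign, by whether it contains 1, and then the reduced word of its cut,
    from which [w] and [a] are read off. *)
Lemma translate_alpha_inj v w a b :
  translate v (alpha a) = translate w (alpha b) -> v = w /\ a = b.
Proof.
have sep l l' : l != [::] -> l' != [::] -> half_tree l = ~` half_tree l' -> False.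
  by move=> l0 l0' /(congr1 (@^~ 1)); rewrite /setC /mkset !half_tree1 l0 l0' => E;
    have := isT; rewrite {1}E; apply.
case: (root_word_cases v a) => [va|[v' [-> va]]];
  case: (root_word_cases w b) => [wb|[w' [-> wb]]].
- rewrite !translate_alpha_pos // => /half_tree_inj-/(_ va wb)/rcons_inj[vw ->].
  by split=> //; apply: val_inj.
- by rewrite translate_alpha_pos // translate_alpha_neg // => /sep[]; apply: rcons_neq0.
- by rewrite translate_alpha_neg // translate_alpha_pos // => /esym/sep[]; apply: rcons_neq0.
rewrite !translate_alpha_neg // => /setC_inj/half_tree_inj-/(_ va wb)/rcons_inj[vw ->].
by split=> //; congr (_ * _); apply: val_inj.
Qed.

Lemma cox_rootsP c : cox_roots (letter_set A) c <-> exists w a, c = translate w (alpha a).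
Proof.
split=> [[w [_ [[a _ <-] ->]]]|[w [a ->]]]; first by exists w, a.
by exists w, (letter a); split=> //; exists a.
Qed.

Lemma pos_root_half_tree c : pos_roots (letter_set A) c ->
  exists w a, [/\ reduced_word (rcons (letters w) a), c = translate w (alpha a) &
    c = half_tree (rcons (letters w) a)].
Proof.
case=> /cox_rootsP[w [a ->]]; case: (root_word_cases w a) => [wa _|[v [-> va]]].
  by exists w, a; split=> //; rewrite translate_alpha_pos.
by rewrite translate_alpha_neg // /setC /mkset half_tree1 rcons_neq0 => /(_ isT).
Qed.

Lemma prenilpotent_nested c d : prenilpotent (letter_set A) c d ->
  exists w v v' a b, let l := rcons (letters v) a in let l' := rcons (letters v') b in
  [/\ reduced_word l /\ reduced_word l', translate w c = translate v (alpha a),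
      translate w d = translate v' (alpha b) & prefix l l' \/ prefix l' l].
Proof.
case=> _ _ [w [pc pd]] [w' [[_ nc] [_ nd]]].
have [v [a [va E Eh]]] := pos_root_half_tree pc.
have [v' [b [vb E' Eh']]] := pos_root_half_tree pd.
exists w, v, v', a, b; split=> //.
(* After translation by [w] both roots are positive, and the vertex w w'^-1 lies outside both. Its
   reduced word extends both cut words, so one of these is a prefix of the other. *)
have {nc}: ~ half_tree (rcons (letters v) a) (w * w'^-1).
  by rewrite -Eh translateE mulKg; move: nc; rewrite translateE mulg1.
have {nd}: ~ half_tree (rcons (letters v') b) (w * w'^-1).
  by rewrite -Eh' translateE mulKg; move: nd; rewrite translateE mulg1.
rewrite /half_tree /= => /negP/negPn p /negP/negPn p'.
have cmp (l l' m : seq A) : prefix l m -> prefix l' m -> size l <= size l' -> prefix l l'.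
  by rewrite !prefixE => p1 /eqP p2 le; rewrite -[X in take _ X == _]p2 take_takel.
case: (leqP (size (rcons (letters v') b)) (size (rcons (letters v) a))) => [le|/ltnW le].
  by right; apply: cmp p p' le.
by left; apply: cmp p' p le.
Qed.

End Halves.

(** * Root groups of order two *)

Section RootGroups.
Variables (A : choiceType) (s t u : A) (G : groupType) (rfl elt : A -> G).
Hypothesis rflK : forall a, rfl a * rfl a = 1.
Hypothesis eltK : forall a, elt a * elt a = 1.
Hypothesis elt_neq1 : forall a, elt a <> 1.
Hypothesis braid : forall a, elt a * rfl a * elt a = rfl a * elt a * rfl a.

Local Notation nw := (extend rfl).
Let nwM := extendM rflK.
Let nw_letterM := extend_letterM rflK.

(** By [translate_alpha_inj] this depends only on the root w alpha_a; it is the nontrivial element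
    of its root group. *)
Definition root_elt w a : G := extend rfl w * elt a * (extend rfl w)^-1.

(* This is {1} if c is not a root. *)
Definition root_grp (c : set (word A)) : set G :=
  [set g | g = 1 \/ exists w a, c = translate w (alpha a) /\ g = root_elt w a].

(** For nonempty reduced [l], the root element of the positive root [half_tree l]; the empty word
    gets the default 1. *)
Fixpoint pos_elt (l : seq A) : G :=
  match l with
  | [::] => 1
  | a :: l' => if l' is [::] then elt a else rfl a * pos_elt l' * rfl a
  end.

Lemma pos_elt_cons a l : l != [::] -> pos_elt (a :: l) = rfl a * pos_elt l * rfl a.
Proof. by case: l. Qed.

Lemma rflV a : (rfl a)^-1 = rfl a. Proof. exact: mulg1_eq. Qed.

Lemma root_eltM v w a : root_elt (v * w) a = nw v * root_elt w a * (nw v)^-1.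
Proof. by rewrite /root_elt nwM invgM !mulgA. Qed.

Lemma root_elt1 a : root_elt 1 a = elt a.
Proof. by rewrite /root_elt extend1 invg1 mulg1 mul1g. Qed.

Lemma root_eltK w a : root_elt w a * root_elt w a = 1.
Proof. by rewrite /root_elt !mulgA mulgVK -(mulgA _ _ (elt a)) eltK mulg1 mulgV. Qed.

Lemma root_elt_neq1 w a : root_elt w a <> 1.
Proof.
move=> /(congr1 (fun x => (nw w)^-1 * x * nw w)).
by rewrite /root_elt mulg1 mulVg !mulgA mulVg mul1g mulgVK => /elt_neq1.
Qed.

Lemma root_elt_pos w a : reduced_word (rcons (letters w) a) ->
  root_elt w a = pos_elt (rcons (letters w) a).
Proof.
elim/word_ind: w => [|b w bw IH]; first by rewrite root_elt1.
rewrite letters_letterM cons_red_alt; last by rewrite reduced_word_cons bw lettersP.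
rewrite rcons_cons => bwa; have := bwa; rewrite reduced_word_cons => /andP[_ wa].
rewrite root_eltM IH // extend_letter rflV /=.
by case: (letters w).
Qed.

Lemma root_grpE w a g : root_grp (translate w (alpha a)) g <-> g = 1 \/ g = root_elt w a.
Proof.
split=> [[->|[v [b [/translate_alpha_inj[-> ->] ->]]]]|[->|->]]; [by left|by right|by left|].
by right; exists w, a.
Qed.

Lemma root_grp_translate v c : root_grp (translate v c) = conj_set (nw v) (root_grp c).
Proof.
apply/seteqP; split=> [g [->|[w [a [E ->]]]]|_ [g [->|[w [a [-> ->]]]] <-]].
- by exists 1; [left|rewrite mulg1 mulgV].
- exists (root_elt (v^-1 * w) a); last by rewrite -root_eltM mulVKg.
  by right; exists (v^-1 * w), a; split=> //; rewrite translateM -E translateK.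
- by left; rewrite mulg1 mulgV.
- by right; exists (v * w), a; split; rewrite ?translateM ?root_eltM.
Qed.

Lemma root_grp_subgroup w a : is_subgroup (root_grp (translate w (alpha a))).
Proof.
split=> [|x y /root_grpE + /root_grpE + |x /root_grpE]; first by left.
  by case=> ->; case=> ->; rewrite ?root_eltK ?mulg1 ?mul1g; apply/root_grpE;
    [left|right|right|left].
case=> ->; rewrite ?invg1; apply/root_grpE; [by left|right].
by apply: mulg1_eq; apply: root_eltK.
Qed.

Let rgd2 a x : root_grp (alpha a) x -> x <> 1 ->
  exists u' u'', [/\ root_grp (~` alpha a) u', root_grp (~` alpha a) u'' &
    forall b, conj_set (u' * x * u'') (root_grp b) = root_grp (translate (letter a) b)].
Proof.
rewrite -{1}[alpha a]translate1 => /root_grpE[//|-> _]; rewrite root_elt1.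
have Na : root_grp (~` alpha a) (rfl a * elt a * rfl a).
  right; exists (letter a), a; split; first by rewrite translate_alpha_self.
  by rewrite /root_elt extend_letter rflV.
(* With n = [rfl a] and u = [elt a], the braid relation collapses (n u n) u (n u n) to n, which
   permutes the root groups as [letter a] does. *)
exists (rfl a * elt a * rfl a), (rfl a * elt a * rfl a); split=> // b.
rewrite root_grp_translate extend_letter -braid; congr conj_set.
by rewrite !mulgA -(mulgA (_ * _) (elt a) (elt a)) eltK mulg1 braid
  -(mulgA (_ * _) (rfl a) (rfl a)) rflK mulg1 -mulgA eltK mulg1.
Qed.

Hypothesis nested : forall g v, g != [::] -> v != [::] -> reduced_word (g ++ v) ->
  pos_elt g * pos_elt (g ++ v) * pos_elt g =
  pos_elt (g ++ v) * (if stu_split s t u g v then pos_elt (rcons g t) else 1).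

Lemma pos_eltK l : pos_elt l * pos_elt l = 1.
Proof.
elim: l => [|a [|b l] IH]; [by rewrite mulg1|exact: eltK|].
rewrite [pos_elt _]/= -/(pos_elt (b :: l)) !mulgA -(mulgA _ (rfl a) (rfl a)) rflK mulg1.
by rewrite -(mulgA (rfl a)) IH mulg1 rflK.
Qed.

Lemma root_gen_subgroup X : is_subgroup (root_gen root_grp X).
Proof. exact: gen_is_subgroup. Qed.

Lemma root_gen_mem X c g : X c -> root_grp c g -> root_gen root_grp X g.
Proof. by move=> Xc cg B [_]; apply; exists c. Qed.

(** The three half-trees form a chain, so the intersection of the outer two is the smallest and that
    of their complements is the complement of the largest. *)
Lemma half_interval (l l' m : seq A) w : reduced_word l -> reduced_word m -> prefix l l' ->
  prefix l' m ->
  cox_roots (letter_set A) (translate w (half_tree l')) ->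
  closed_interval (letter_set A) (translate w (half_tree l)) (translate w (half_tree m))
    (translate w (half_tree l')).
Proof.
move=> rl rm ll' l'm Sc; apply: closed_intervalP => // x; rewrite /setC /setI /mkset !translateE.
  by rewrite /half_tree /=; move=> [+ _]; apply: contra => /(prefix_trans ll').
by rewrite /half_tree /= => -[_ /negP/negPn xm]; apply/negP/negPn; apply: prefix_trans l'm xm.
Qed.

Lemma closed_interval_sym (S : set (word A)) a b : closed_interval S a b = closed_interval S b a.
Proof.
by apply/seteqP; split=> c [Sc H]; split=> // w; have [H1 H2] := H w; split=> ? ?;
  [apply: H1|apply: H2|apply: H1|apply: H2].
Qed.

Lemma commg_pos_elt g v : g != [::] -> v != [::] -> reduced_word (g ++ v) ->
  [~ pos_elt (g ++ v), pos_elt g] = if stu_split s t u g v then pos_elt (rcons g t) else 1.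
Proof.
move=> g0 v0 rgv; have V k : (pos_elt k)^-1 = pos_elt k by apply: mulg1_eq; rewrite pos_eltK.
by rewrite /commg /conjg !V (mulgA (pos_elt g)) nested // mulgA pos_eltK mul1g.
Qed.

Let comm_nested w v v' a b : let l := rcons (letters v) a in let l' := rcons (letters v') b in
  reduced_word l -> reduced_word l' -> prefix l l' -> l != l' ->
  root_gen root_grp
    (open_interval (letter_set A) (translate (w * v) (alpha a)) (translate (w * v') (alpha b)))
  [~ root_elt (w * v') b, root_elt (w * v) a].
Proof.
move=> l l' rl rl' ll' nll'.
rewrite !root_eltM !root_elt_pos // -/l -/l' !translateM !translate_alpha_pos // -/l -/l'.
case/prefixP: (ll') => m l'E; have m0 : m != [::].
  by apply: contra_neq nll' => m0; rewrite l'E m0 cats0.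
have conjR (x y z : G) : [~ x * y * x^-1, x * z * x^-1] = x * [~ y, z] * x^-1.
  by have := conjRg y z x^-1; rewrite /conjg invgK !mulgA => ->.
have [g1 _ _] := root_gen_subgroup (open_interval (letter_set A) (translate w (half_tree l))
  (translate w (half_tree l'))).
rewrite conjR.
have -> : [~ pos_elt l', pos_elt l] = if stu_split s t u l m then pos_elt (rcons l t) else 1.
  by rewrite l'E commg_pos_elt ?rcons_neq0 -?l'E.
(* In the only nontrivial case l' is l followed by t and u, and the cut at l t lies strictly between
   those at l and l'. *)
case: ifP => [/andP[_ /eqP mE]|_]; last by rewrite mulg1 mulgV.
have l'tE : l' = rcons (rcons l t) u by rewrite l'E mE -!cats1 -catA.
have rlt : reduced_word (rcons l t).
  by move: rl'; rewrite l'tE reduced_word_rcons2 => /andP[].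
have rlt' : reduced_word (rcons (letters (Word rl)) t) by [].
apply: (@root_gen_mem _ (translate w (half_tree (rcons l t)))); last first.
  rewrite root_grp_translate; exists (pos_elt (rcons l t)) => //.
  right; exists (Word rl), t;
  split; [by rewrite (translate_alpha_pos rlt')|by rewrite (root_elt_pos rlt')].
split.
  apply: half_interval => //; first by rewrite prefix_rcons.
    by rewrite l'tE prefix_rcons.
  by apply/cox_rootsP; exists (w * Word rl), t; rewrite translateM (translate_alpha_pos rlt').
have tI : injective (translate w) by move=> x y /(congr1 (translate w^-1)); rewrite !translateK.
case=> /tI/half_tree_inj.
  by move=> /(_ rlt rl)/(congr1 size)/eqP; rewrite size_rcons eqn_leq ltnn.
by move=> /(_ rlt rl')/(congr1 size)/eqP; rewrite l'tE !size_rcons eqn_leq ltnn andbF.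
Qed.

Let rgd1 c d : prenilpotent (letter_set A) c d -> c <> d ->
  commutator (root_grp c) (root_grp d) `<=` root_gen root_grp (open_interval (letter_set A) c d).
Proof.
move=> cd; have [w [v [v' [a [b [[rl rl'] Ec Ed pp]]]]]] := prenilpotent_nested cd.
have {Ec}-> : c = translate (w^-1 * v) (alpha a) by rewrite translateM -Ec translateK.
have {Ed}-> : d = translate (w^-1 * v') (alpha b) by rewrite translateM -Ed translateK.
set c1 := translate _ _; set d1 := translate _ _ => nE.
have [g1 gM gV] := root_gen_subgroup (open_interval (letter_set A) c1 d1).
apply: smallest_sub; first exact: root_gen_subgroup.
move=> _ [x /root_grpE cx] [y /root_grpE dy <-].
case: cx => ->; first by rewrite comm1g.
case: dy => ->; first by rewrite commg1.
have nll : rcons (letters v) a != rcons (letters v') b.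
  apply/eqP => /rcons_inj[E ab]; apply: nE; rewrite /c1 /d1 ab.
  by rewrite (_ : v = v') //; apply: val_inj.
(* [comm_nested] puts the longer word first in the commutator, so one direction of nesting needs an
   inversion and the other a symmetric interval. *)
case: pp => pp; first by rewrite -invgR; apply: gV; exact: comm_nested.
rewrite /open_interval closed_interval_sym setUC; apply: comm_nested => //.
by rewrite eq_sym.
Qed.

Variable P : set G.
Hypothesis subP : is_subgroup P.
Hypothesis P_pos : forall l, reduced_word l -> P (pos_elt l).
Hypothesis P_neg : forall a, ~ P (rfl a * elt a * rfl a).
Hypothesis generated : forall g, exists h x,
  [/\ forall a, commute h (rfl a) /\ commute h (elt a),
      gen (range rfl `|` range elt) x & g = h * x].

Lemma root_grp_neg a : root_grp (~` alpha a) (rfl a * elt a * rfl a).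
Proof.
right; exists (letter a), a; split; first by rewrite translate_alpha_self.
by rewrite /root_elt extend_letter rflV.
Qed.

(** All positive root groups lie in the subgroup [P], which the generator of the root group of
    -alpha_a avoids. *)
Let rgd3 a : ~ (root_grp (~` alpha a) `<=` root_gen root_grp (pos_roots (letter_set A))).
Proof.
move=> /(_ _ (root_grp_neg a)) H; have := @P_neg a; apply; apply: H; split=> //.
move=> g [c pc cg]; have [w [b [rw cE _]]] := pos_root_half_tree pc.
move: cg; rewrite cE => /root_grpE[->|->]; first by case: subP.
by rewrite root_elt_pos //; apply: P_pos.
Qed.

Lemma alpha_root a : cox_roots (letter_set A) (alpha a).
Proof. by apply/cox_rootsP; exists 1, a; rewrite translate1. Qed.

(** By the braid relation n = u (n u n) u, so each [rfl a] is a product of elements of the root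
    groups of alpha_a and -alpha_a. *)
Lemma root_gen_roots x : gen (range rfl `|` range elt) x ->
  root_gen root_grp (cox_roots (letter_set A)) x.
Proof.
apply: smallest_sub => [|_ [] [a _ <-]]; first exact: root_gen_subgroup.
- have [_ gM _] := root_gen_subgroup (cox_roots (letter_set A)).
  have e : root_gen root_grp (cox_roots (letter_set A)) (elt a).
    apply: root_gen_mem (alpha_root a) _; right; exists 1, a.
    by rewrite translate1 root_elt1.
  have f : root_gen root_grp (cox_roots (letter_set A)) (rfl a * elt a * rfl a).
    apply: root_gen_mem (root_grp_neg a); rewrite -translate_alpha_self.
    exact/cox_roots_translate/alpha_root.
  have -> : rfl a = elt a * (rfl a * elt a * rfl a) * elt a; last exact: (gM _ _ (gM _ _ e f) e).
  by rewrite -braid !mulgA eltK mul1g -mulgA eltK mulg1.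
- apply: root_gen_mem (alpha_root a) _; right; exists 1, a.
  by rewrite translate1 root_elt1.
Qed.

Let torus_commute h : (forall a, commute h (rfl a) /\ commute h (elt a)) ->
  torus (letter_set A) root_grp h.
Proof.
move=> hC _ /cox_rootsP[w [a ->]]; rewrite /normalizer /mkset.
have hw : commute h (nw w).
  elim/word_ind: w => [|b w _ IH]; first exact: commute1.
  by rewrite nw_letterM; apply: commuteM => //; case: (hC b).
have hr : commute h (root_elt w a).
  by apply: commuteM; [apply: commuteM => //; case: (hC a)|apply: commuteV].
have E g : root_grp (translate w (alpha a)) g -> h * g * h^-1 = g.
  by move=> /root_grpE[->|->]; rewrite ?hr ?mulg1 ?mulgK ?mulgV.
apply/seteqP; split=> [_ [g rg <-]|g rg]; first by rewrite E.
by exists g => //; rewrite E.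
Qed.

Lemma root_grp_rgd : is_rgd (letter_set A) root_grp.
Proof.
split=> [c /cox_rootsP[w [a ->]]|||_ [a _ <-]|g].
- split; first exact: root_grp_subgroup.
  move=> E; apply: (@root_elt_neq1 w a).
  have : root_grp (translate w (alpha a)) (root_elt w a) by apply/root_grpE; right.
  by rewrite E.
- exact: rgd1.
- move=> _ x [a _ <-] ax x1; have [u' [u'' [? ? H]]] := rgd2 ax x1.
  by exists u', u''; split=> // b _; apply: H.
- exact: rgd3.
- have [h [x [hC gx ->]]] := generated g.
  by exists h, x; split=> //; [apply: torus_commute|apply: root_gen_roots].
Qed.

End RootGroups.

(** * The group acting on the chambers *)

Record sym (T : Type) := Sym {
  sfun : T -> T;
  sinv : T -> T;
  sfunK : cancel sfun sinv;
  sinvK : cancel sinv sfun }.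

HB.instance Definition _ T := gen_eqMixin (sym T).
HB.instance Definition _ T := gen_choiceMixin (sym T).

Section Sym.
Variable T : Type.
Implicit Types f g h : sym T.

Lemma sym_ext f g : sfun f =1 sfun g -> f = g.
Proof.
case: f g => [f f' fK f'K] [g g' gK g'K] /= /funext fg; subst g.
have E : f' = g' by apply/funext=> x; rewrite -{1}[x]g'K fK.
by subst g'; congr Sym; apply: Prop_irrelevance.
Qed.

Definition sym_mul f g : sym T := Sym (can_comp (sfunK f) (sfunK g)) (can_comp (sinvK g) (sinvK
  f)).
Definition sym_inv f : sym T := Sym (sinvK f) (sfunK f).
Definition sym_one : sym T := @Sym T id id (fun=> erefl) (fun=> erefl).

Lemma sym_mulA : associative sym_mul. Proof. by move=> f g h; apply: sym_ext. Qed.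
Lemma sym_mul1 : left_id sym_one sym_mul. Proof. by move=> f; apply: sym_ext. Qed.
Lemma sym_mulr1 : right_id sym_one sym_mul. Proof. by move=> f; apply: sym_ext. Qed.
Lemma sym_mulV : left_inverse sym_one sym_inv sym_mul.
Proof. by move=> f; apply: sym_ext => x /=; rewrite sfunK. Qed.
Lemma sym_mulrV : right_inverse sym_one sym_inv sym_mul.
Proof. by move=> f; apply: sym_ext => x /=; rewrite sinvK. Qed.

HB.instance Definition _ := isGroup.Build (sym T) sym_mulA sym_mul1 sym_mulr1 sym_mulV sym_mulrV.

End Sym.

Section Chambers.
Variables (A : choiceType) (s t u : A).
Hypotheses (st : s != t) (tu : t != u) (su : s != u).
Implicit Types (g v : seq A) (x y : seq (A * bool)).

(** The length of [x] suffices as bound: each recursive call removes a letter and the action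
    preserves lengths ([act_cons]). *)
Definition act g x := act_rec s t u (size x) g x.

Lemma act_unzip g x : unzip1 (act g x) = unzip1 x.
Proof. exact: act_rec_unzip. Qed.

Lemma size_act g x : size (act g x) = size x.
Proof. by rewrite -(size_map fst (act g x)) -/(unzip1 _) act_unzip size_map. Qed.

Definition act_twist r d y := act d (if stu_split s t u [:: r] d then act [:: t] y else y).

Lemma act_cons q g r e x : act (q :: g) ((r, e) :: x) =
  if r == q then
    if g is [::] then (r, ~~ e) :: x
    else (r, e) :: if e then act_twist r g x else act g x
  else (r, e) ::
    if e then act [:: r] (act_twist r (q :: g) (act [:: r] x)) else act [:: r, q & g] x.
Proof.
have tE d y : size y = size x -> twist s t u (size x) r d y = act_twist r d y.
  move=> yx; rewrite /twist /act_twist; case: ifP => _; last by rewrite /act yx.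
  by rewrite {1}/act size_act yx /act yx.
rewrite {1}/act [size _]/= act_recE.
case: eqP => _; first by case: g => // q' g; case: e; rewrite ?tE.
case: e => //; congr cons.
rewrite -/(act [:: r] x) tE ?size_act //; apply/esym.
by rewrite {1}/act {1}/act_twist size_act; case: ifP; rewrite !size_act.
Qed.

Lemma act_invol g : involutive (act g).
Proof.
by move=> x; rewrite {1}/act size_act; have [I _] := act_rec_rel st tu su (size x); exact: I.
Qed.

Lemma act_nested g v x : g != [::] -> v != [::] ->
  act g (act (g ++ v) (act g x)) =
  act (g ++ v) (if stu_split s t u g v then act (rcons g t) x else x).
Proof.
move=> g0 v0; have [_ N] := act_rec_rel st tu su (size x); have := N g v x g0 v0.
have sz k y : size (act_rec s t u (size x) k y) = size y.
  by rewrite -[LHS](size_map fst) -/(unzip1 _) act_rec_unzip size_map.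
have E k y : size y = size x -> act k y = act_rec s t u (size x) k y by rewrite /act => ->.
by case: (stu_split s t u g v) => N'; rewrite !E ?sz ?size_act // N'.
Qed.

(** The element n_r: it exchanges the piece of the base chamber with the (r, false) piece. Its
    action by u_r on the (r, true) piece is forced by the braid relation. *)
Definition refl_act r x :=
  if x is (q, e) :: y then
    if q == r then if e then (q, e) :: act [:: r] y else y else (r, false) :: x
  else [:: (r, false)].

Definition reduced_chamber x := reduced_word (unzip1 x).

Lemma reduced_chamber_cons r e x :
  reduced_chamber ((r, e) :: x) = (ohead (unzip1 x) != Some r) && reduced_chamber x.
Proof. exact: reduced_word_cons. Qed.

Lemma refl_act_fresh r x : ohead (unzip1 x) != Some r -> refl_act r x = (r, false) :: x.
Proof. by case: x => //= [[q e] y] /= qr; rewrite ifN //; apply: contra_neq qr => ->. Qed.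

Lemma act_reduced g x : reduced_chamber x -> reduced_chamber (act g x).
Proof. by rewrite /reduced_chamber act_unzip. Qed.

Lemma refl_act_reduced r x : reduced_chamber x -> reduced_chamber (refl_act r x).
Proof.
case: x => //= [[q e] y]; case: eqVneq => [->|qr] rx; last first.
  by rewrite reduced_chamber_cons rx /= andbT; apply: contra_neq qr => -[].
move: rx; rewrite reduced_chamber_cons => /andP[yr ry]; case: e => //.
by rewrite reduced_chamber_cons act_unzip yr act_reduced.
Qed.

Lemma refl_actK r x : reduced_chamber x -> refl_act r (refl_act r x) = x.
Proof.
case: x => [_|[q e] y]; first by rewrite /= eqxx.
rewrite reduced_chamber_cons => /andP[yq ry].
rewrite [refl_act r (_ :: _)]/=; case: eqVneq => [<-|qr].
  by case: e; rewrite /= ?eqxx ?act_invol // refl_act_fresh.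
by rewrite /= eqxx.
Qed.

Lemma act_letter r e y : act [:: r] ((r, e) :: y) = (r, ~~ e) :: y.
Proof. by rewrite act_cons eqxx. Qed.

Lemma refl_act_false r y : refl_act r ((r, false) :: y) = y.
Proof. by rewrite /= eqxx. Qed.

Lemma refl_act_true r y : refl_act r ((r, true) :: y) = (r, true) :: act [:: r] y.
Proof. by rewrite /= eqxx. Qed.

Definition refl_actE := (act_letter, refl_act_false, refl_act_true).

Variant chamber_spec r x : Prop :=
| ChamberBase of ohead (unzip1 x) != Some r
| ChamberPanel e y of x = (r, e) :: y & ohead (unzip1 y) != Some r.

Lemma chamberP r x : reduced_chamber x -> chamber_spec r x.
Proof.
case: x => [|[q e] y] rx; first by left.
have [qr|qr] := eqVneq q r; last by left; apply: contra_neq qr => -[].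
by move: rx; rewrite reduced_chamber_cons qr => /andP[yr _]; apply: (@ChamberPanel _ _ e y).
Qed.

Lemma refl_act_braid r x : reduced_chamber x ->
  act [:: r] (refl_act r (act [:: r] x)) = refl_act r (act [:: r] (refl_act r x)).
Proof.
case/(chamberP r) => [xr|[] y -> yr]; rewrite ?refl_actE //.
- by rewrite (refl_act_fresh xr) refl_actE refl_act_fresh ?act_unzip // !refl_actE.
- by rewrite refl_act_fresh ?act_unzip.
Qed.

(** One branch of [act_rec] for each of the three pieces at the r-panel; on the (r, true) piece the
    conjugations by u_r cancel and leave the twist. *)
Lemma refl_act_conj r g x : g != [::] -> reduced_word (r :: g) -> reduced_chamber x ->
  refl_act r (act g (refl_act r x)) = act (r :: g) x.
Proof.
case: g => // q g _; rewrite reduced_word_cons => /andP[/= qr _].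
have {}qr : r != q by apply: contra_neq qr => ->.
case/(chamberP r) => [xr|[] y -> yr].
- by rewrite (refl_act_fresh xr) act_cons (negPf qr) refl_actE.
- by rewrite !refl_actE act_cons (negPf qr) act_cons eqxx !refl_actE !act_invol.
- by rewrite !refl_actE refl_act_fresh ?act_unzip // act_cons eqxx.
Qed.

Record chamber := Chamber { chamber_word : seq (A * bool);
  chamberE : reduced_chamber chamber_word }.
HB.instance Definition _ := [isSub for chamber_word].

Definition act_chamber g (x : chamber) := Chamber (act_reduced g (chamberE x)).
Definition refl_chamber r (x : chamber) := Chamber (refl_act_reduced r (chamberE x)).

Lemma act_chamberK g : involutive (act_chamber g).
Proof. by move=> x; apply: val_inj; apply: act_invol. Qed.

Lemma refl_chamberK r : involutive (refl_chamber r).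
Proof. by move=> x; apply: val_inj; apply: refl_actK (chamberE x). Qed.

Definition act_sym g : sym chamber := Sym (act_chamberK g) (act_chamberK g).
Definition refl_sym r : sym chamber := Sym (refl_chamberK r) (refl_chamberK r).

Lemma chamber_sym_ext (f f' : sym chamber) :
  (forall x : chamber, chamber_word (sfun f x) = chamber_word (sfun f' x)) -> f = f'.
Proof. by move=> E; apply: sym_ext => x; apply: val_inj; apply: E. Qed.

Lemma refl_symK r : refl_sym r * refl_sym r = 1.
Proof. by apply: sym_ext => x; apply: refl_chamberK. Qed.

Lemma act_symK g : act_sym g * act_sym g = 1.
Proof. by apply: sym_ext => x; apply: act_chamberK. Qed.

Lemma act_sym_braid r : act_sym [:: r] * refl_sym r * act_sym [:: r] =
  refl_sym r * act_sym [:: r] * refl_sym r.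
Proof. by apply: chamber_sym_ext => x; apply: refl_act_braid (chamberE x). Qed.

Lemma act_sym_conj r g : g != [::] -> reduced_word (r :: g) ->
  refl_sym r * act_sym g * refl_sym r = act_sym (r :: g).
Proof. by move=> g0 rg; apply: chamber_sym_ext => x; apply: refl_act_conj g0 rg (chamberE x). Qed.

Lemma act_sym_nested g v : g != [::] -> v != [::] ->
  act_sym g * act_sym (g ++ v) * act_sym g =
  act_sym (g ++ v) * (if stu_split s t u g v then act_sym (rcons g t) else 1).
Proof.
move=> g0 v0; apply: chamber_sym_ext => x; rewrite /= act_nested //.
by case: ifP.
Qed.

Lemma act_sym_pos l : reduced_word l ->
  pos_elt refl_sym (fun r => act_sym [:: r]) l = act_sym l.
Proof.
elim: l => [_|a [|b l] IH rl] //.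
  by apply: chamber_sym_ext => x; rewrite /= /act act_rec_one.
move: (rl); rewrite reduced_word_cons => /andP[_ /IH {}IH].
by rewrite -act_sym_conj // -IH.
Qed.

Definition base_chamber : chamber := Chamber (isT : reduced_chamber [::]).

Lemma act_sym_base g : sfun (act_sym g) base_chamber = base_chamber.
Proof. by apply: val_inj; rewrite /= /act act_rec_nil. Qed.

(** The base chamber goes to (r, false), then to (r, true), and n_r keeps the (r, true) piece. *)
Lemma act_sym_neg_base r :
  sfun (refl_sym r * act_sym [:: r] * refl_sym r) base_chamber <> base_chamber.
Proof. by move=> /(congr1 chamber_word); rewrite /= act_letter /= eqxx. Qed.

Lemma act_sym_neq1 r : act_sym [:: r] <> 1.
Proof.
move/(congr1 (fun f : sym chamber => chamber_word (sfun f (refl_chamber r base_chamber)))).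
by rewrite /= act_letter.
Qed.

(** This element is the commutator that linearity would make trivial; it moves the chamber (s,
    false) (t, false). *)
Lemma act_sym_st_neq1 : act_sym [:: s; t] <> 1.
Proof.
move/(congr1 (fun f : sym chamber => chamber_word (sfun f (refl_chamber s (refl_chamber t
  base_chamber))))).
by rewrite /= eq_sym (negPf st) act_cons eqxx act_letter.
Qed.

End Chambers.

(** * A localization of the rational numbers as a torus *)

(** A copy of the rationals whose group law, written multiplicatively, is addition; powers in it are
    integer multiples. *)
Definition addrat := rat.
HB.instance Definition _ := Choice.copy addrat rat.
HB.instance Definition _ := @isGroup.Build addrat (0 : rat)%R (fun x : rat => - x)%R
  (fun x y : rat => x + y)%R (@addrA rat) (@add0r rat) (@addr0 rat) (@addNr rat) (@addrN rat).

Lemma addrat_mul (x y : addrat) : x * y = (x + y :> rat)%R. Proof. by []. Qed.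

Lemma addrat_exp (x : addrat) n : x ^+ n = (x *+ n :> rat)%R.
Proof. by elim: n => // n IH; rewrite expgS mulrS IH. Qed.

Definition unit_fractions (P : set nat) : set addrat :=
  [set x | exists2 n, (0 < n)%N /\ (forall p, prime p -> p %| n -> P p) & x = (n%:R^-1 : rat)%R].

Definition rat_localization (P : set nat) : set addrat :=
  gen (unit_fractions P).

(** On generators, 1/n is p times 1/(pn); divisibility by p passes to sums and opposites. *)
Lemma rat_localization_div P p x : prime p -> P p -> rat_localization P x ->
  exists2 y, rat_localization P y & y ^+ p = x.
Proof.
move=> pp Pp; have p0 : (p%:R != 0 :> rat)%R by rewrite pnatr_eq0 -lt0n prime_gt0.
have [g1 gM gV] := gen_is_subgroup (unit_fractions P).
apply: (@smallest_sub _ _ _ [set x | exists2 y, rat_localization P y & y ^+ p = x]); last first.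
  move=> _ [n [n0 nP] ->]; exists ((p * n)%:R^-1 : rat)%R.
    move=> B [_]; apply; exists (p * n)%N => //; split; first by rewrite muln_gt0 prime_gt0.
    by move=> q pq; rewrite Euclid_dvdM // => /orP[|/nP];
      [rewrite dvdn_prime2 // => /eqP->|apply].
  by rewrite addrat_exp natrM invfM -[LHS]mulr_natr mulrAC mulVf // mul1r.
split=> [|_ _ [x1 gx <-] [y gy <-]|_ [y gy <-]].
- by exists 1 => //; rewrite expg1n.
- by exists (x1 * y); [exact: gM|rewrite !addrat_exp !addrat_mul mulrnDl].
- by exists y^-1; [exact: gV|rewrite expVgn].
Qed.

(** The localization lies in the group [B] of rationals having a denominator prime to p, and 1/p
    does not. *)
Lemma rat_localization_ndiv P p : prime p -> ~ P p -> ~ rat_localization P (p%:R^-1 : rat)%R.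
Proof.
move=> pp nP; set B := [set x : addrat | exists m (z : int),
  coprime p m /\ ((x : rat) * m%:R = z%:~R)%R].
suff sB : rat_localization P `<=` B.
  move=> /sB[m [z [pm E]]]; have pz : (m%:Z = z * p%:Z)%R.
    have := congr1 (fun x => x * p%:R)%R E; rewrite mulrAC mulVf ?mul1r ?pnatr_eq0 -?lt0n
      ?prime_gt0 //.
    by move=> /eqP; rewrite !pmulrn -intrM eqr_int => /eqP.
  have : p %| m by move/(congr1 absz): pz; rewrite abszM /= => ->; apply: dvdn_mull.
  by move: pm; rewrite prime_coprime // => /negP.
apply: smallest_sub => [|_ [n [n0 nPn] ->]].
  split=> [|x y [m [z [pm xE]]] [m' [z' [pm' yE]]]|x [m [z [pm xE]]]].
  - by exists 1%N, 0%R; rewrite coprimen1 mul0r.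
  - exists (m * m')%N, (z * m'%:Z + z' * m%:Z)%R; rewrite coprimeMr pm pm'; split=> //.
    by rewrite addrat_mul natrM mulrDl mulrA xE [(m%:R * _)%R]mulrC mulrA yE rmorphD !rmorphM.
  - by exists m, (- z)%R; split=> //; rewrite mulNr xE rmorphN.
exists n, 1%R; rewrite mulVf ?pnatr_eq0 -?lt0n //; split=> //.
by rewrite prime_coprime //; apply/negP => /(nPn _ pp).
Qed.

(** * The RGD system attached to a set of primes *)

Section System.
Variables (A : choiceType) (s t u : A).
Hypotheses (st : s != t) (tu : t != u) (su : s != u).
Variable P : set nat.

Let Refl := refl_sym st tu su.
Let Elt r := act_sym st tu su [:: r].

Definition twisted_pred : pred (sym (chamber A) * addrat)%type :=
  fun g => `[< gen (range Refl `|` range Elt) g.1 /\ rat_localization P g.2 >].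

Lemma twisted_closed : group_closed twisted_pred.
Proof.
have [a1 aM aV] := gen_is_subgroup (range Refl `|` range Elt).
have [b1 bM bV] : is_subgroup (rat_localization P) := gen_is_subgroup _.
split; first by apply/asboolP.
move=> x y /asboolP[x1 x2] /asboolP[y1 y2]; apply/asboolP.
by split; [apply: aM => //; apply: aV|apply: bM => //; apply: bV].
Qed.

Record twisted := Twisted { twisted_val : sym (chamber A) * addrat;
  twistedP : twisted_pred twisted_val }.
HB.instance Definition _ := [isSub for twisted_val].
HB.instance Definition _ := [Choice of twisted by <:].
HB.instance Definition _ := SubChoice_isSubGroup.Build _ _ twisted twisted_closed.

Lemma gen_Refl r : gen (range Refl `|` range Elt) (Refl r).
Proof. by move=> B [_]; apply; left; exists r. Qed.

Lemma gen_Elt r : gen (range Refl `|` range Elt) (Elt r).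
Proof. by move=> B [_]; apply; right; exists r. Qed.

Lemma twisted_pred_pair f (k : addrat) : gen (range Refl `|` range Elt) f ->
  rat_localization P k ->
  twisted_pred (f, k).
Proof. by move=> ? ?; apply/asboolP. Qed.

Lemma rat_localization1 : rat_localization P 1.
Proof. by case: (gen_is_subgroup (unit_fractions P)). Qed.

Definition twisted_refl r : twisted := Twisted (twisted_pred_pair (gen_Refl r) rat_localization1).
Definition twisted_elt r : twisted := Twisted (twisted_pred_pair (gen_Elt r) rat_localization1).

Lemma twisted_val_inj : injective twisted_val.
Proof. exact: val_inj. Qed.

Lemma twisted_valM (x y : twisted) : twisted_val (x * y) = (twisted_val x * twisted_val y).
Proof. exact: valM. Qed.

Lemma twisted_val1 : twisted_val 1 = 1.
Proof. exact: val1. Qed.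

Lemma pair_mul1 (f g : sym (chamber A)) :
  (f, 1 : addrat) * (g, 1 : addrat) = (f * g, 1 : addrat).
Proof. by []. Qed.

Lemma twisted_pos_elt l : reduced_word l ->
  twisted_val (pos_elt twisted_refl twisted_elt l) = (act_sym st tu su l, 1).
Proof.
move=> rl; rewrite -act_sym_pos //.
elim: l {rl} => [|a [|b l] IH]; [exact: twisted_val1|by []|].
by rewrite pos_elt_cons // (pos_elt_cons (refl_sym st tu su)) // !twisted_valM IH !pair_mul1.
Qed.

(** The subgroup used for (RGD3): it contains the positive root elements and none of the negative
    simple ones. *)
Definition fix_base : set twisted :=
  [set g | sfun (twisted_val g).1 (base_chamber A) = base_chamber A].

Lemma twisted_reflK a : twisted_refl a * twisted_refl a = 1.
Proof. by apply: twisted_val_inj; rewrite twisted_val1 twisted_valM pair_mul1 refl_symK. Qed.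

Lemma twisted_eltK a : twisted_elt a * twisted_elt a = 1.
Proof. by apply: twisted_val_inj; rewrite twisted_val1 twisted_valM pair_mul1 act_symK. Qed.

Lemma twisted_elt_neq1 a : twisted_elt a <> 1.
Proof.
move=> /(congr1 twisted_val); rewrite twisted_val1 => /(congr1 fst).
exact: act_sym_neq1.
Qed.

Lemma twisted_braid a : twisted_elt a * twisted_refl a * twisted_elt a =
  twisted_refl a * twisted_elt a * twisted_refl a.
Proof. by apply: twisted_val_inj; rewrite !twisted_valM !pair_mul1 act_sym_braid. Qed.

Lemma reduced_word_catl (l l' : seq A) : reduced_word (l ++ l') -> reduced_word l.
Proof. by move=> /cat_sorted2[]. Qed.

Lemma stu_split_reduced g v : stu_split s t u g v -> reduced_word (g ++ v) ->
  reduced_word (rcons g t).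
Proof. by case/andP=> _ /eqP->; rewrite -cat_rcons => /reduced_word_catl. Qed.

Lemma twisted_nested g v : g != [::] -> v != [::] -> reduced_word (g ++ v) ->
  pos_elt twisted_refl twisted_elt g * pos_elt twisted_refl twisted_elt (g ++ v) *
    pos_elt twisted_refl twisted_elt g =
  pos_elt twisted_refl twisted_elt (g ++ v) *
    (if stu_split s t u g v then pos_elt twisted_refl twisted_elt (rcons g t) else 1).
Proof.
move=> g0 v0 rgv; have rg := reduced_word_catl rgv.
apply: twisted_val_inj; rewrite !twisted_valM !twisted_pos_elt // !pair_mul1 act_sym_nested //.
case: ifP => [sp|_]; last by rewrite twisted_val1 !mulg1.
by rewrite twisted_pos_elt ?pair_mul1 // (stu_split_reduced sp).
Qed.

(** The splitting (f, k) = (1, k) (f, 1): the first factor is central and serves as torus part, the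
    second is a product of the generators. *)
Lemma twisted_decompose (g : twisted) : exists h x : twisted,
  [/\ (twisted_val h).1 = 1, (twisted_val h).2 = (twisted_val g).2,
      gen (range twisted_refl `|` range twisted_elt) x, (twisted_val x).2 = 1 & g = h * x].
Proof.
case: g => -[f k] gP; have /asboolP[/= gf gk] := gP.
have [r1 _ _] := gen_is_subgroup (range Refl `|` range Elt).
have [x gx xE] : exists2 x,
    gen (range twisted_refl `|` range twisted_elt) x & twisted_val x = (f, 1).
  have [b1 bM bV] := gen_is_subgroup (range twisted_refl `|` range twisted_elt).
  apply: (@smallest_sub _ _ _ [set f | exists2 x,
    gen (range twisted_refl `|` range twisted_elt) x & twisted_val x = (f, 1)] _ _ f gf).
    split=> [|f1 f2 [x1 gx1 x1E] [x2 gx2 x2E]|f1 [x1 gx1 x1E]].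
    - by exists 1; rewrite ?twisted_val1.
    - by exists (x1 * x2); [exact: bM|rewrite twisted_valM x1E x2E pair_mul1].
    - exists x1^-1; first exact: bV.
      have -> : twisted_val x1^-1 = (twisted_val x1)^-1 by exact: (gmulfV val x1).
      by rewrite x1E; congr (_, _); exact: invg1.
  move=> _ [] [r _ <-]; [exists (twisted_refl r)|exists (twisted_elt r)] => //.
    by move=> B [_]; apply; left; exists r.
  by move=> B [_]; apply; right; exists r.
exists (Twisted (twisted_pred_pair r1 gk)), x; split=> //; first by rewrite xE.
apply: twisted_val_inj; rewrite twisted_valM xE /=.
by transitivity (1 * f, k * 1 : addrat); first by rewrite mul1g mulg1.
Qed.

Lemma twisted_rgd : is_rgd (letter_set A) (root_grp twisted_refl twisted_elt).
Proof.
apply: (@root_grp_rgd A s t u _ _ _ twisted_reflK twisted_eltK twisted_elt_neq1 twisted_braid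
  twisted_nested fix_base).
- split=> [|x y|x]; rewrite /fix_base /mkset.
  + by rewrite twisted_val1.
  + by rewrite twisted_valM /= => xb ->.
  + move=> xb; have -> : twisted_val x^-1 = (twisted_val x)^-1 by exact: (gmulfV val x).
    by rewrite /= -{1}xb sfunK.
- by move=> l rl; rewrite /fix_base /mkset twisted_pos_elt // act_sym_base.
- move=> a; rewrite /fix_base /mkset !twisted_valM !pair_mul1.
  exact: act_sym_neg_base.
- move=> g; have [h [x [h1 h2 gx x2 ->]]] := twisted_decompose g.
  exists h, x; split=> // a.
  have C (y : twisted) : (twisted_val y).2 = 1 -> commute h y.
    move=> y2; apply: twisted_val_inj; rewrite !twisted_valM; move: h1 y2.
    case: (twisted_val h) => h1' h2'; case: (twisted_val y) => y1' y2' /= -> ->.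
    transitivity (1 * y1', h2' * 1 : addrat); first by [].
    by transitivity (y1' * 1, 1 * h2' : addrat); first by rewrite !mul1g !mulg1.
  by split; apply: C.
Qed.

End System.

(** * Invariants of isomorphisms *)

Lemma is_hom1 (G H : groupType) (f : G -> H) : is_hom f -> f 1 = 1.
Proof. by move=> fM; apply: (@mulgI _ (f 1)); rewrite -fM !mulg1. Qed.

Lemma is_homV (G H : groupType) (f : G -> H) x : is_hom f -> f x^-1 = (f x)^-1.
Proof. by move=> fM; symmetry; apply: mulg1_eq; rewrite -fM mulgV is_hom1. Qed.

Lemma is_homX (G H : groupType) (f : G -> H) x n : is_hom f -> f (x ^+ n) = f x ^+ n.
Proof. by move=> fM; elim: n => [|n IH]; rewrite ?is_hom1 // !expgS fM IH. Qed.

Section Family.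
Variables (A : choiceType) (s t u : A).
Hypotheses (st : s != t) (tu : t != u) (su : s != u).

Local Notation U P := (root_grp (twisted_refl st tu su P) (twisted_elt st tu su P)).

Definition twisted_system (P : set nat) : rgd_system :=
  RGDSystem (@word_coxeter A) (twisted_rgd st tu su P).

Lemma is_hom_preim1 (G H : groupType) (f : G -> H) :
  is_hom f -> is_subgroup [set x | f x = 1].
Proof.
move=> fM; split=> [|x y /= fx fy|x /= fx]; first exact: is_hom1.
  by rewrite fM fx fy mulg1.
by rewrite is_homV // fx invg1.
Qed.

Definition twisted_snd P (x : twisted st tu su P) : addrat := (twisted_val x).2.

Lemma twisted_sndM P : is_hom (@twisted_snd P).
Proof. by move=> x y; rewrite /twisted_snd twisted_valM. Qed.

Lemma twisted_snd_root_grp P c g : U P c g -> twisted_snd g = 1.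
Proof.
have [T1 TM TV] := is_hom_preim1 (@twisted_sndM P).
case=> [->|[w [a [_ ->]]]]; first exact: T1.
have Tw : twisted_snd (extend (twisted_refl st tu su P) w) = 1.
  elim/word_ind: w => [|b w _ IH]; first exact: T1.
  by rewrite extend_letterM; [apply: TM|exact: twisted_reflK].
by apply: (TM _ _ (TM _ _ Tw _) (TV _ Tw)).
Qed.

(** The preimage of (1, 1) is a p-th power times an element [x] generated by root groups. Mapping
    back and projecting to the rationals kills [x], so 1 would be p times an element of the
    localization at [Q]. *)
Lemma twisted_system_not_iso P Q p : prime p -> P p -> ~ Q p ->
  ~ rgd_isomorphic (twisted_system P) (twisted_system Q).
Proof.
move=> pp Pp nQp [q [h [_ _ [hM [h' hK h'K]] hU]]].
have oP : twisted_pred st tu su Q (1, 1%R : addrat).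
  apply: twisted_pred_pair; first by case: (gen_is_subgroup (range (refl_sym st tu su) `|`
    range (fun r : A => act_sym st tu su [:: r]))).
  move=> B [_]; apply; exists 1%N; rewrite ?invr1 //; split=> // r rp; rewrite dvdn1 => /eqP r1.
  by rewrite r1 in rp.
have [h0 [x [h01 h02 gx x2 gE]]] := twisted_decompose (h' (Twisted oP)).
have /asboolP[_ Kg] := twistedP h0.
have [y0 Ky y0E] := rat_localization_div pp Pp Kg.
have yP : twisted_pred st tu su P (1, y0).
  by apply: twisted_pred_pair => //; case: (gen_is_subgroup (range (refl_sym st tu su) `|`
    range (fun r : A => act_sym st tu su [:: r]))).
have h0E : h0 = Twisted yP ^+ p.
  have eM : is_hom (fun f : twisted st tu su P => (twisted_val f).1) by move=> ? ?;
    rewrite twisted_valM.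
  apply: twisted_val_inj; move: h01 (is_homX (Twisted yP) p eM) (is_homX (Twisted yP) p
    (@twisted_sndM P)).
  rewrite /twisted_snd /= -/(twisted_val h0).2 y0E expg1n; case: (twisted_val h0) => ? ? /= ->.
  by case: (twisted_val (_ ^+ _)) => ? ? /= -> ->.
(* The isomorphism sends root groups to root groups, on which the rational component is trivial. *)
have hx : twisted_snd (h x) = 1.
  have hsM : is_hom (fun f => twisted_snd (h f)) by move=> ? ?; rewrite hM twisted_sndM.
  have rx := root_gen_roots (twisted_reflK st tu su P) (twisted_eltK st tu su P) (twisted_braid
    st tu su P) gx.
  apply: (@smallest_sub _ _ _ [set f | twisted_snd (h f) = 1] _ _ x rx);
    first exact: is_hom_preim1.
  move=> f [c Sc cf]; have : (h @` rgd_U (twisted_system P) c) (h f) by exists f.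
  by rewrite hU //; apply: twisted_snd_root_grp.
have := congr1 (fun z => twisted_snd (h z)) gE.
rewrite /= h'K hM twisted_sndM hx mulg1 h0E is_homX // is_homX; last exact: twisted_sndM.
rewrite addrat_exp /twisted_snd /= => E.
have /asboolP[_] := twistedP (h (Twisted yP)).
have p0 : (p%:R != 0 :> rat)%R by rewrite pnatr_eq0 -lt0n prime_gt0.
have -> : (twisted_val (h (Twisted yP))).2 = (p%:R^-1)%R.
  by apply: (mulIf p0); rewrite mulVf // mulr_natr.
exact: rat_localization_ndiv.
Qed.

End Family.

(** * Reflections of a root basis *)

Lemma scalarE (R : pzRingType) (V : lmodType R) (f : {scalar V}) x v : (f (x *: v) = x * f v)%R.
Proof. exact: linearZ. Qed.

Section Refl.
Local Open Scope ring_scope.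
Variables (R : realType) (V : lmodType R) (f : {scalar V}) (c : V).

Definition hrefl v := v - f v *: c.

Lemma hrefl_linear : linear hrefl.
Proof.
by move=> x v w; rewrite /hrefl linearP /= scalerDl opprD scalerBr scalerA addrACA.
Qed.

Lemma hreflK : f c = 2 -> involutive hrefl.
Proof.
move=> fc v; rewrite /hrefl linearB scalarE fc -addrA -opprD -scalerDl.
by rewrite (_ : f v + _ = 0) ?scale0r ?subr0 //; ring.
Qed.

End Refl.

Section LinearMaps.
Local Open Scope ring_scope.
Variables (R : pzRingType) (V : lmodType R).

Lemma linear_comp (p q : V -> V) : linear p -> linear q -> linear (p \o q).
Proof. by move=> pL qL x v w /=; rewrite qL pL. Qed.

Variable p : V -> V.
Hypothesis pL : linear p.

Lemma linear_fun0 : p 0 = 0.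
Proof. by have := pL (-1) 0 0; rewrite scaleN1r oppr0 addr0 scaleN1r addNr. Qed.

Lemma linear_funZ x v : p (x *: v) = x *: p v.
Proof. by have := pL x v 0; rewrite linear_fun0 !addr0. Qed.

Lemma linear_funD v w : p (v + w) = p v + p w.
Proof. by have := pL 1 v w; rewrite !scale1r. Qed.

Lemma linear_funN v : p (- v) = - p v.
Proof. by rewrite -scaleN1r linear_funZ scaleN1r. Qed.

Lemma linear_iter n : linear (iter n p).
Proof. by elim: n => // n IH x v w /=; rewrite IH pL. Qed.

End LinearMaps.

(** * Finite order of the product of two reflections *)

Section DihedralOrder.
Local Open Scope ring_scope.
Variables (R : realType) (V : lmodType R) (f g : {scalar V}) (a b : V) (k : nat).
Hypotheses (fa : f a = 2) (gb : g b = 2) (k3 : (3 <= k)%N).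
Hypothesis fgE : f b * g a = 4 * cos (pi / k%:R) ^+ 2.

Let rot v := hrefl f a (hrefl g b v).
Let comb x y := x *: a + y *: b.

Let theta : R := (pi / k%:R) *+ 2.
Let S (n : nat) := sin (theta *+ n).

Let k0 : (k%:R : R) != 0.
Proof. by rewrite pnatr_eq0; case: k k3. Qed.

Let cE : f b * g a = 2 + 2 * cos theta.
Proof. by rewrite fgE cos_mulr2n mulr2n; ring. Qed.

Let theta_bounds : 0 < theta < pi.
Proof.
have p0 : (0 : R) < pi := pi_gt0 R; have kR : (3 : R) <= k%:R by rewrite ler_nat.
have E : theta = 2 * pi / k%:R by rewrite /theta mulr2n; ring.
by rewrite E divr_gt0 ?mulr_gt0 ?ltr_pdivrMr ?(lt_le_trans _ kR) //=; nra.
Qed.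

Let S1 : sin theta != 0.
Proof. by rewrite gt_eqF // sin_gt0_pi. Qed.

Let SS n : S n.+2 = 2 * cos theta * S n.+1 - S n.
Proof.
rewrite /S; have -> : theta *+ n.+2 = theta *+ n.+1 + theta by rewrite [RHS]addrC -mulrS.
have -> : theta *+ n = theta *+ n.+1 - theta by rewrite mulrSr addrK.
by rewrite sinD sinB; ring.
Qed.

Let Sk : S k = 0 /\ S k.-1 = - sin theta.
Proof.
have tk : theta *+ k = pi *+ 2.
  by rewrite /theta -mulrnA mulnC mulrnA -[_ *+ k]mulr_natr divfK.
have E : theta *+ k.-1 = - theta + pi *+ 2.
  by rewrite -tk; case: k k3 => // n _; rewrite mulrS addKr.
by rewrite /S tk sin2pi E sinD2pi sinN.
Qed.

Let rotL : linear rot.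
Proof. by apply: (@linear_comp _ _ (hrefl f a) (hrefl g b)); apply: hrefl_linear. Qed.

Let rot_comb x y : rot (comb x y) =
  comb (f b * (y + g a * x) - x) (- y - g a * x).
Proof.
rewrite /rot; have -> : hrefl g b (comb x y) = comb x (- y - g a * x).
  rewrite /hrefl /comb linearD !scalarE gb -addrA -scalerBl; congr (_ + _ *: _); ring.
rewrite /hrefl /comb linearD !scalarE fa addrAC -scalerBl; congr (_ *: _ + _); ring.
Qed.

(** On the span of [a] and [b], [rot] satisfies the characteristic equation of a plane rotation by
    [theta] = 2 pi / k. *)
Let rot2 x y : rot (rot (comb x y)) = (2 * cos theta) *: rot (comb x y) - comb x y.
Proof.
rewrite !rot_comb /comb scalerDr !scalerA [- (_ *: a + _)]opprD addrACA -!scalerBl.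
have -> : 2 * cos theta = f b * g a - 2 by rewrite cE; ring.
by congr (_ *: _ + _ *: _); ring.
Qed.

(** Powers by the recurrence of sin(n theta); at n + 1 = k the coefficients become 0 and - sin
    theta, so the k-th power is the identity. *)
Let iter_rot n x y : sin theta *: iter n.+1 rot (comb x y) =
  S n.+1 *: rot (comb x y) - S n *: comb x y.
Proof.
elim: n => [|n IH]; first by rewrite /S mulr0n sin0 scale0r subr0.
rewrite iterS -(linear_funZ rotL) IH (linear_funD rotL) (linear_funN rotL) !(linear_funZ rotL)
  rot2.
by rewrite SS scalerBr scalerBl scalerA [_ * S n.+1]mulrC addrAC -!addrA; congr (_ + _).
Qed.

Lemma dihedral_order v : iter k (fun v => hrefl f a (hrefl g b v)) v = v.
Proof.
have comb_fix x y : iter k rot (comb x y) = comb x y.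
  apply: (scalerI S1); have [Sk0 Sk1] := Sk.
  have kE : k = k.-1.+1 by case: k k3.
  by rewrite {1}kE iter_rot -kE Sk0 Sk1 scale0r sub0r scaleNr opprK.
(* The determinant of the system f (x a + y b) = f v, g (x a + y b) = g v. Cramer's rule gives [x]
   and [y], and the remainder [w] is fixed by both reflections. *)
pose d : R := 4 - f b * g a.
have d0 : d != 0.
  have : cos theta < 1.
    rewrite lt_neqAle cos_le1 andbT; apply: contra_neq S1 => c1.
    by apply: cos1sin0; rewrite c1 normr1.
  by rewrite /d cE => c1; rewrite gt_eqF //; lra.
pose x := (2 * f v - f b * g v) / d; pose y := (2 * g v - g a * f v) / d.
pose w := v - comb x y.
have fw : f w = 0.
  by rewrite linearB linearD !scalarE fa /x /y /d; field.
have gw : g w = 0.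
  by rewrite linearB linearD !scalarE gb /x /y /d; field.
have rw : rot w = w.
  by rewrite /rot /hrefl gw scale0r subr0 fw scale0r subr0.
have -> : v = comb x y + w by rewrite addrC subrK.
rewrite -/rot (linear_funD (linear_iter rotL k)) comb_fix; congr (_ + _).
by have /= -> := iter_fix k rw.
Qed.

End DihedralOrder.

(** * The cone spanned by the simple roots *)

Section NonnegSpan.
Local Open Scope ring_scope.
Variables (R : realType) (B : root_basis R).
Local Notation V := (rb_V B).
Local Notation NN := (@nonneg_span R B).

Lemma nonneg_span_simple (a : V) : simples a -> NN a.
Proof.
by move=> Sa; exists 1%N, (fun=> 1), (fun=> a); split=> [i|]; rewrite ?ler01 // big_ord1 scale1r.
Qed.

Lemma nonneg_spanD v w : NN v -> NN w -> NN (v + w).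
Proof.
case=> [n [c [a [ca ->]]]] [m [d [b [db ->]]]].
exists (n + m)%N, (fun i => match fintype.split i with inl j => c j | inr j => d j end),
  (fun i => match fintype.split i with inl j => a j | inr j => b j end).
split=> [i|]; first by case: fintype.split.
rewrite big_split_ord; congr (_ + _); apply: eq_bigr => i _.
  by rewrite -[lshift m i]/(unsplit (inl i)) unsplitK.
by rewrite -[rshift n i]/(unsplit (inr i)) unsplitK.
Qed.

Lemma nonneg_spanZ x v : 0 <= x -> NN v -> NN (x *: v).
Proof.
move=> x0 [n [c [a [ca ->]]]]; exists n, (fun i => x * c i), a; split=> [i|].
  by have [? ?] := ca i; rewrite mulr_ge0.
by rewrite scaler_sumr; apply: eq_bigr => i _; rewrite scalerA.
Qed.

(** The functional of (RB3) is nonnegative on the cone, and vanishes on a nonnegative combination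
    only if each of its terms is zero. *)
Lemma nonneg_span_salient v : NN v -> NN (- v) -> v = 0.
Proof.
have [f fpos] := rb_positive B.
have fge w : NN w -> 0 <= f w.
  case=> [n [c [a [ca ->]]]]; rewrite linear_sum sumr_ge0 // => i _.
  by have [? ?] := ca i; rewrite scalarE mulr_ge0 // ltW // fpos.
move=> Nv /fge; rewrite linearN /= oppr_ge0 => fv0.
have {fv0}fv : f v = 0 by apply/eqP; rewrite eq_le fv0 fge.
case: Nv fv => [n [c [a [ca ->]]]]; rewrite linear_sum => /eqP.
rewrite psumr_eq0 => [/allP c0|i _]; last first.
  by have [? ?] := ca i; rewrite scalarE mulr_ge0 // ltW // fpos.
rewrite big1 // => i _; have := c0 i (mem_index_enum i); rewrite scalarE /= mulf_eq0.
have [_ /fpos fa] := ca i.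
by rewrite (gt_eqF fa) orbF => /eqP->; rewrite scale0r.
Qed.

(** The functional of (RB3) is negative on r_a(a) = - a, but positive on r_b(a) for b distinct from
    a, as the pairing is nonpositive. *)
Lemma reflection_simple_inj (a b : V) : simples a -> simples b ->
  reflection a = reflection b -> a = b.
Proof.
move=> Sa Sb E; have [//|ab] := eqVneq a b; have [f fpos] := rb_positive B.
have : f (reflection a a) = f (reflection b a) by rewrite E.
rewrite /reflection !linearB !scalarE rb_two //.
have : coroot b a <= 0.
  by case: (rb_pairing Sa Sb ab) => [[-> _]|[/ltW]].
by move: (fpos a Sa) (fpos b Sb) => ? ? ? ?; exfalso; clear E ab fpos; nra.
Qed.

Lemma reflection_linear (a : V) : linear (reflection a).
Proof. exact: hrefl_linear. Qed.

Lemma reflectionK (a : V) : simples a -> involutive (reflection a).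
Proof. by move=> Sa; apply: hreflK; apply: rb_two. Qed.

Lemma reflection_self (a : V) : simples a -> reflection a a = - a.
Proof. by move=> Sa; rewrite /reflection rb_two // -{1}[a]scale1r -scalerBl -scaleN1r;
  congr (_ *: _); ring. Qed.

End NonnegSpan.

(** * Root bases associated with the universal Coxeter group *)

Section UniversalBasis.
Local Open Scope ring_scope.
Variables (R : realType) (B : root_basis R) (A : choiceType).
Local Notation V := (rb_V B).
Local Notation NN := (@nonneg_span R B).
Variable rho : word A -> V -> V.
Hypothesis ident : identification (letter_set A) rho.

Let rhoM v w x : rho (v * w)%g x = rho v (rho w x).
Proof. by case: ident => -> _ _ _. Qed.

Let rho_inj : injective rho. Proof. by case: ident. Qed.

Lemma simple_vec_ex r : exists a, simples a /\ rho (letter r) = reflection a.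
Proof.
case: ident => _ _ _ E; have : (rho @` letter_set A) (rho (letter r))
  by exists (letter r) => //; exists r.
by rewrite E => -[a Sa <-]; exists a.
Qed.

Definition simple_vec r : V := sval (cid (simple_vec_ex r)).

Lemma simple_vecP r : simples (simple_vec r).
Proof. by rewrite /simple_vec; case: cid => a []. Qed.

Lemma rho_letter r : rho (letter r) = reflection (simple_vec r).
Proof. by rewrite /simple_vec; case: cid => a []. Qed.

Lemma simple_vec_surj a : simples a -> exists r, simple_vec r = a.
Proof.
move=> Sa; case: ident => _ _ _ E; have : reflections (reflection a) by exists a.
rewrite -E => -[_ [r _ <-] rE]; exists r.
by apply: reflection_simple_inj (simple_vecP r) Sa _; rewrite -rho_letter.
Qed.

Lemma simple_vec_inj : injective simple_vec.
Proof. by move=> r q E; apply/(@letter_inj A)/rho_inj; rewrite !rho_letter E. Qed.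

Lemma rho1 : rho 1%g = id.
Proof.
have [a /simple_vec_surj[r _]] := rb_nonempty B.
by apply/funext=> x; rewrite -(letterK r) rhoM rho_letter reflectionK //; apply: simple_vecP.
Qed.

Lemma rhoK w : cancel (rho w) (rho w^-1%g).
Proof. by move=> x; rewrite -rhoM mulVg rho1. Qed.

Lemma rho_linear w : linear (rho w).
Proof.
elim/word_ind: w => [|r w _ IH] x v v'; first by rewrite rho1.
by rewrite !rhoM IH rho_letter reflection_linear.
Qed.

Lemma rho_order v n : (forall x, iter n (rho v) x = x) -> (v ^+ n = 1)%g.
Proof.
move=> vn; apply: rho_inj; rewrite rho1; apply/funext=> x; rewrite -[RHS]vn.
by elim: n {vn} x => [|n IH] x; rewrite ?rho1 // expgSr rhoM IH -iterSr.
Qed.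

(* The reflection of [simple_vec q] maps [simple_vec r] to
   [simple_vec r + m q r *: simple_vec q]. *)
Let m q r := - coroot (simple_vec q) (simple_vec r).

(* The values 4 * cos (pi / k) ^+ 2 < 4 are excluded since they give a product of
   reflections of order dividing k, which cannot occur in universal type. *)
Lemma m_bounds q r : q != r -> 0 < m q r /\ 4 <= m q r * m r q.
Proof.
move=> qr; have vqr : simple_vec q != simple_vec r by apply: contra_neq qr => /simple_vec_inj.
have univ n : (0 < n)%N -> ~ forall x, iter n (rho (letter q * letter r)%g) x = x.
  move=> n0 /rho_order; have lqr : letter q != letter r by apply: contra_neq qr => /letter_inj.
  have Sq : letter_set A (letter q) by exists q.
  have Sr : letter_set A (letter r) by exists r.
  by move/(word_universal Sq Sr lqr) => n00; rewrite n00 in n0.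
have rhoE x : rho (letter q * letter r)%g x = hrefl (coroot (simple_vec q)) (simple_vec q)
    (hrefl (coroot (simple_vec r)) (simple_vec r) x) by rewrite rhoM !rho_letter.
rewrite /m mulrNN oppr_gt0.
case: (rb_pairing (simple_vecP q) (simple_vecP r) vqr) => [[rq0 qr0]|[rq0 qr0 H]].
  (* Zero pairings make the two reflections commute, so their product would have order dividing
     2. *)
  exfalso; apply: (univ 2 isT) => x /=; rewrite !rhoM !rho_letter.
  have C y : reflection (simple_vec q) (reflection (simple_vec r) y) =
      reflection (simple_vec r) (reflection (simple_vec q) y).
    by rewrite /reflection !linearB !scalarE rq0 qr0 !mulr0 !subr0 addrAC.
  by rewrite C (reflectionK (simple_vecP q)) (reflectionK (simple_vecP r)).
split=> //; rewrite mulrC; case: H => // -[k k1 E].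
(* For k = 1 the product is 4, as wanted; for k = 2 it is 0, against both pairings being negative;
   for k >= 3 the order would be finite. *)
case: k k1 E => [//|[|[|k]]] _ E.
- by rewrite E invr1 mulr1 cospi sqrrN expr1n mulr1.
- by move: E; rewrite cos_pihalf expr0n mulr0 => E;
  have := nmulr_rgt0 (coroot (simple_vec q) (simple_vec r)) rq0; rewrite E ltxx qr0.
exfalso; apply: (univ k.+3 isT) => x; rewrite (eq_iter rhoE).
apply: dihedral_order => //; try exact: rb_two (simple_vecP _).
by rewrite mulrC.
Qed.

Lemma reflection_simple q r :
  reflection (simple_vec q) (simple_vec r) = simple_vec r + m q r *: simple_vec q.
Proof. by rewrite /reflection /m scaleNr. Qed.

(** For [l] the reduced word of w, this is the action of w^-1 ([rho_wordV]), one letter at a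
    time. *)
Definition descend l v := foldl (fun v r => reflection (simple_vec r) v) v l.

Lemma descend_cons r l v : descend (r :: l) v = descend l (reflection (simple_vec r) v).
Proof. by []. Qed.

Lemma rho_wordV w v : rho w^-1%g v = descend (letters w) v.
Proof.
elim/word_ind: w v => [|r w rw IH] v; first by rewrite invg1 rho1.
rewrite letters_letterM cons_red_alt; last by rewrite reduced_word_cons rw lettersP.
by rewrite invgM letterV rhoM IH rho_letter.
Qed.

Lemma descend_linear l : linear (descend l).
Proof. by elim: l => // r l IH x v w; rewrite !descend_cons reflection_linear IH. Qed.

(* The condition [2 * x <= y * m r q] says that reflecting in [simple_vec r]
   does not decrease the coefficient [x] of [simple_vec r]. *)
Lemma descend_rank2 l r q x y : reduced_word l -> r != q -> ohead l != Some q ->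
  0 <= x -> 0 <= y -> 2 * x <= y * m r q ->
  NN (descend l (x *: simple_vec r + y *: simple_vec q)).
Proof.
elim: l r q x y => [|p l IH] r q x y.
  move=> _ _ _ x0 y0 _; apply: nonneg_spanD; apply: nonneg_spanZ => //;
    exact/nonneg_span_simple/simple_vecP.
rewrite reduced_word_cons => /andP[lp rl] rq pq x0 y0 xy.
have {}pq : p != q by apply: contra_neq pq => ->.
have [Er|pr] := eqVneq p r.
  (* Reflecting in r stays in the plane and exchanges the roles of r and q; the invariant survives
     because m r q * m q r >= 4. *)
  rewrite {p pq}Er descend_cons in lp *; have [mrq0 mm] := m_bounds rq.
  rewrite reflection_linear -[_ *: simple_vec q]addr0 reflection_linear.
  have -> : reflection (simple_vec r) 0 = 0 by apply: linear_fun0; exact: reflection_linear.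
  have -> : x *: reflection (simple_vec r) (simple_vec r) +
      (y *: reflection (simple_vec r) (simple_vec q) + 0) =
      y *: simple_vec q + (y * m r q - x) *: simple_vec r.
    rewrite addr0 reflection_self ?reflection_simple; last exact: simple_vecP.
    by rewrite scalerN scalerDr scalerA scalerBl addrC addrA.
  have mqr : 0 < m q r by have [] := m_bounds (q := q) (r := r); rewrite 1?eq_sym.
  apply: IH => //; first by rewrite eq_sym.
    nra.
  have : y * 4 <= y * (m r q * m q r) by rewrite ler_wpM2l.
  have : 2 * x * m q r <= y * m r q * m q r by rewrite ler_wpM2r // ltW.
  nra.
(* The next letter differs from r and q, so the two simple vectors are treated separately, each
   starting a new rank two descent with p. *)
have DL := descend_linear (p :: l).
rewrite DL -[y *: _]addr0 DL (linear_fun0 DL) addr0.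
have H z : p != z -> NN (descend (p :: l) (simple_vec z)).
  move=> pz; rewrite descend_cons reflection_simple -[simple_vec z]scale1r.
  have [mpz0 mm] := m_bounds pz.
  apply: IH => //; [by rewrite eq_sym|by rewrite ltW|].
  by rewrite mulrC in mm *; rewrite mulr1; lra.
by apply: nonneg_spanD; apply: nonneg_spanZ => //; apply: H.
Qed.

Lemma descend_simple l r : reduced_word l -> ohead l != Some r ->
  NN (descend l (simple_vec r)).
Proof.
case: l => [|p l]; first by move=> _ _; exact/nonneg_span_simple/simple_vecP.
rewrite reduced_word_cons => /andP[lp rl] pr; have {}pr : p != r by apply: contra_neq pr => ->.
rewrite descend_cons reflection_simple -[simple_vec r]scale1r.
have [mpr0 mm] := m_bounds pr.
by apply: descend_rank2 => //; [rewrite eq_sym|rewrite ltW|lra].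
Qed.

Lemma alpha_nonneg w r : alpha r w -> NN (rho w^-1%g (simple_vec r)).
Proof.
by rewrite /alpha simple_root_word => wr; rewrite rho_wordV;
  apply: descend_simple (lettersP w) wr.
Qed.

Lemma alphaN_nonneg w r : ~ alpha r w -> NN (- rho w^-1%g (simple_vec r)).
Proof.
move=> nr; have : alpha r (letter r * w)%g.
  have : (~` alpha r) w by [].
  by rewrite -translate_alpha_self translateE letterV.
move/alpha_nonneg; rewrite invgM letterV rhoM rho_letter reflection_self; last exact: simple_vecP.
by rewrite (linear_funN (@rho_linear _)).
Qed.

Lemma simple_vec_neq0 r : simple_vec r != 0.
Proof.
apply/eqP => r0; have := rb_two (simple_vecP r); rewrite r0 linear0 => /esym/eqP.
by rewrite pnatr_eq0.
Qed.

Lemma rho_eq0 w v : rho w v = 0 -> v = 0.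
Proof. by move=> wv; rewrite -[v](rhoK w) wv (linear_fun0 (@rho_linear _)). Qed.

Lemma translate_nonneg w r z : translate w (alpha r) z -> NN (rho z^-1%g (rho w (simple_vec r))).
Proof. by rewrite translateE => /alpha_nonneg; rewrite invgM invgK rhoM. Qed.

Lemma translateN_nonneg w r z : ~ translate w (alpha r) z ->
  NN (- rho z^-1%g (rho w (simple_vec r))).
Proof. by rewrite translateE => /alphaN_nonneg; rewrite invgM invgK rhoM. Qed.

Lemma nonneg_translate w r z : NN (rho z^-1%g (rho w (simple_vec r))) -> translate w (alpha r) z.
Proof.
move=> N; have [//|/translateN_nonneg N'] := pselect (translate w (alpha r) z).
have := nonneg_span_salient N N' => /rho_eq0/rho_eq0/eqP.
by rewrite (negPf (simple_vec_neq0 r)).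
Qed.

Lemma weyl_rho w : weyl (rho w).
Proof. by case: ident => _ _ <- _; exists w. Qed.

Lemma rho_root w r : rb_roots (rho w (simple_vec r)).
Proof. by exists (rho w), (simple_vec r); split=> //; [exact: weyl_rho|exact: simple_vecP]. Qed.

Lemma half_space_rho w r : half_space rho (rho w (simple_vec r)) = translate w (alpha r).
Proof.
apply/seteqP; split=> z; rewrite /half_space /mkset; first by case=> _ /nonneg_translate.
by move=> /translate_nonneg N; split=> //; rewrite -rhoM; apply: rho_root.
Qed.

(** The choice in [root_vector] is unambiguous: every root vector is some rho w (a_r), and its
    half-space determines w and r. *)
Lemma root_vector_translate w r : root_vector rho (translate w (alpha r)) = rho w (simple_vec r).
Proof.
apply: xget_unique => [|v [[f [a [Wf /simple_vec_surj[q <-] ->]]]]].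
  by split; [exact: rho_root|exact: half_space_rho].
have [w' _ <-] : range rho f by case: ident => _ _ -> _.
by rewrite half_space_rho => /translate_alpha_inj[-> ->].
Qed.

(** A root in the linear interval lies between the two nested half-trees, so it could only be s
    alpha_t; signs of pairings with coroots exclude this one. *)
Lemma lin_open_interval_empty s t u : s != t -> t != u -> s != u ->
  lin_open_interval (letter_set A) rho (alpha s)
    (translate (letter s * letter t)%g (alpha u)) = set0.
Proof.
move=> st tu su.
have lst : letters (letter s * letter t)%g = [:: s; t] by rewrite /= eq_sym (negPf st).
have rstu : reduced_word (rcons (letters (letter s * letter t)%g) u).
  by rewrite lst /= !reduced_word_cons /= !(inj_eq Some_inj) eq_sym st eq_sym tu.
have bE := translate_alpha_pos rstu.
apply/seteqP; split=> // c [[/cox_rootsP[w [r cE]]]].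
rewrite {c}cE -{1}[alpha s]translate1 !root_vector_translate rho1 => -[x [y [x0 y0 E]]] nab.
(* Nonnegative combinations inherit signs: a root in the linear interval contains the intersection
   of the two roots, and by [subN] dually for complements. *)
have sub z : alpha s z -> translate (letter s * letter t)%g (alpha u) z ->
  translate w (alpha r) z.
  rewrite -{1}[alpha s]translate1 => /translate_nonneg az /translate_nonneg bz.
  apply: nonneg_translate; rewrite E rho1 in az *.
  by rewrite (linear_funD (@rho_linear _)) !(linear_funZ (@rho_linear _)); apply: nonneg_spanD;
    apply: nonneg_spanZ.
have subN z : ~ alpha s z -> ~ translate (letter s * letter t)%g (alpha u) z ->
  ~ translate w (alpha r) z.
  rewrite -{1}[alpha s]translate1 => /translateN_nonneg az /translateN_nonneg bz
    /translate_nonneg cz.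
  have /(nonneg_span_salient cz)/rho_eq0/rho_eq0/eqP : NN (- rho z^-1%g (rho w (simple_vec r))).
    rewrite E rho1 in az *.
    by rewrite (linear_funD (@rho_linear _)) !(linear_funZ (@rho_linear _)) opprD -!scalerN;
      apply: nonneg_spanD; apply: nonneg_spanZ.
  by rewrite (negPf (simple_vec_neq0 r)).
rewrite bE lst alpha_half_tree /= in sub subN nab; rewrite lst /= in rstu.
have rst : reduced_word [:: s; t].
  by move: rstu; rewrite -[[:: s; t; u]]/([:: s; t] ++ [:: u]) => /cat_sorted2[].
have nest z : half_tree [:: s] z -> half_tree [:: s; t; u] z.
  by move: z; apply/(half_tree_subP _ rstu); rewrite /= eqxx.
(* The candidate contains 1 because both ends do, hence it is positive. *)
case: (root_word_cases w r) => [wr|[v [wE vr]]]; last first.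
  have : translate w (alpha r) 1%g by apply: sub.
  by rewrite wE translate_alpha_neg // /setC /mkset half_tree1 rcons_neq0 => /(_ isT).
rewrite (translate_alpha_pos wr) in sub subN nab.
have p1 : prefix [:: s] (rcons (letters w) r).
  by apply/half_tree_subP => // z sz; apply: sub => //; apply: nest.
have p2 : prefix (rcons (letters w) r) [:: s; t; u].
  apply/half_tree_subP => // z cz; have [//|nz] := pselect (half_tree [:: s; t; u] z).
  by case: (subN z) => // sz; apply: nz; apply: nest.
have wrE : rcons (letters w) r = [:: s; t].
  case: (rcons (letters w) r) p1 p2 nab => [|p [|p' [|p'' [|p3 l]]]] //=;
    rewrite ?andbT ?andbF //.
  - by move=> /eqP<- _ [] /=; left.
  - by move=> /eqP<- /andP[_ /eqP->].
  - by move=> /eqP<- /and3P[_ /eqP-> /eqP->] []; right.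
have [wE rE] : w = letter s /\ r = t.
  by move: wrE; rewrite -[[:: s; t]]/(rcons (letters (letter s)) t) => /rcons_inj[wE ->];
    split=> //; apply: val_inj.
(* Applying r_s to s(a_t) = x a_s + y s t(a_u) gives a_t = - x a_s + y t(a_u). *)
have {E} : simple_vec t + x *: simple_vec s = y *: (simple_vec u + m t u *: simple_vec t).
  have := congr1 (reflection (simple_vec s)) E; rewrite {E}wE rE rhoM !rho_letter reflectionK;
    last exact: simple_vecP.
  move=> E'; rewrite {1}E' => {E'}; have sL := @reflection_linear _ B (simple_vec s).
  rewrite (linear_funD sL) !(linear_funZ sL) (reflectionK (simple_vecP s)).
  rewrite reflection_self; last exact: simple_vecP.
  by rewrite reflection_simple scalerN addrAC addNr add0r.
(* Simple roots may be linearly dependent, so coefficients cannot be compared; the coroots of s and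
   u give two scalar equations instead. *)
move=> E; have := congr1 (coroot (simple_vec u)) E; have := congr1 (coroot (simple_vec s)) E.
rewrite !(linearD, scalarE) !rb_two; try exact: simple_vecP.
have ut : u != t by rewrite eq_sym.
have us : u != s by rewrite eq_sym.
have [mut _] := m_bounds ut; have [mus _] := m_bounds us.
have [mst _] := m_bounds st; have [msu _] := m_bounds su.
have [mtu _] := m_bounds tu.
rewrite -[coroot _ _]opprK -/(m s t) -[coroot (simple_vec s) (simple_vec u)]opprK -/(m s u).
rewrite -[coroot (simple_vec u) (simple_vec t)]opprK -/(m u t)
  -[coroot (simple_vec u) (simple_vec s)]opprK -/(m u s).
move: (m u t) (m u s) (m s t) (m s u) (m t u) mut mus mst msu mtu =>
  a b c d e a0 b0 c0 d0 e0 E1 E2.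
clear - x0 y0 a0 b0 c0 d0 e0 E1 E2.
have xb : 0 <= x * b by rewrite mulr_ge0 // ltW.
have yd : 0 <= y * d by rewrite mulr_ge0 // ltW.
(* The equations read a (1 - y e) + x b + 2 y = 0 and c (y e - 1) + 2 x + y d = 0; the first is
   impossible if y e <= 1, the second if y e > 1. *)
have [ye|ye] := lerP (y * e) 1.
  have : 0 <= a * (1 - y * e) by rewrite mulr_ge0 ?subr_ge0 // ltW.
  move=> ae; have y00 : y = 0 by lra.
  by rewrite y00 in E2; lra.
have : 0 < c * (y * e - 1) by rewrite mulr_gt0 // subr_gt0.
by lra.
Qed.

End UniversalBasis.

(** * Conclusion *)

Section NotLinearizable.
Variables (R : realType) (A : choiceType) (s t u : A).
Hypotheses (st : s != t) (tu : t != u) (su : s != u).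
Variable P : set nat.

(** Over the empty linear interval the commutator of the root elements of s and stu would be
    trivial, but it is the root element of st. *)
Lemma twisted_system_not_linearizable : ~ linearizable R (twisted_system st tu su P).
Proof.
case=> B [rho [_ ident lin]].
have rstu : reduced_word [:: s; t; u] by rewrite !reduced_word_cons /= !(inj_eq Some_inj)
  eq_sym st eq_sym tu.
have lst : letters (letter s * letter t) = [:: s; t] by rewrite /= eq_sym (negPf st).
have rstu' : reduced_word (rcons (letters (letter s * letter t)) u) by rewrite lst.
have bE := translate_alpha_pos rstu'; rewrite lst in bE.
have pre : prenilpotent (letter_set A) (alpha s) (translate (letter s * letter t) (alpha u)).
  have ra := alpha_root s.
  have rb : cox_roots (letter_set A) (translate (letter s * letter t) (alpha u)).
    by apply/cox_rootsP; exists (letter s * letter t), u.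
  split=> //.
    by exists 1; rewrite !translate1; split; split=> //; [rewrite alpha_half_tree|rewrite bE].
  (* The vertex stu lies outside both half-trees, so moving it to 1 makes both roots negative. *)
  exists (Word rstu)^-1; split.
    split; first exact: cox_roots_translate.
    by rewrite translateE invgK mulg1 alpha_half_tree /half_tree /= eqxx.
  split; first exact: cox_roots_translate.
  by rewrite translateE invgK mulg1 bE /half_tree /= !eqxx.
have ab : alpha s <> translate (letter s * letter t) (alpha u).
  rewrite -{1}[alpha s]translate1 => /translate_alpha_inj[_ /eqP].
  by rewrite (negPf su).
set rf := twisted_refl st tu su P; set el := twisted_elt st tu su P.
have C : [~ pos_elt rf el [:: s], pos_elt rf el [:: s; t; u]] = 1.
  have := lin _ _ pre ab; rewrite lin_open_interval_empty // => H.
  suff : [set 1] [~ pos_elt rf el [:: s], pos_elt rf el [:: s; t; u]] by [].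
  apply: (@smallest_sub _ _ _ [set 1]) (H _ _).
  - split=> // [x y -> ->|x ->]; [exact: mulg1|exact: invg1].
  - by move=> x [].
  - move=> D [_]; apply; exists (pos_elt rf el [:: s]).
      by right; exists 1, s; rewrite translate1 root_elt1.
    exists (pos_elt rf el [:: s; t; u]) => //; right; exists (letter s * letter t), u; split=> //.
    by rewrite root_elt_pos ?lst //; exact: twisted_reflK.
have := @commg_pos_elt A s t u _ rf el (twisted_reflK st tu su P) (twisted_eltK st tu su P)
  (@twisted_nested A s t u st tu su P) [:: s] [:: t; u] isT isT rstu.
rewrite [[:: s] ++ _]/= -invgR C invg1 /stu_split !eqxx [rcons _ _]/=.
move/(congr1 (@twisted_val _ _ _ _ _ _ _ _)); rewrite twisted_pos_elt; last first.
  by rewrite reduced_word_cons /= (inj_eq Some_inj) eq_sym st.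
by rewrite twisted_val1 => /(congr1 fst)/esym; exact: act_sym_st_neq1.
Qed.

End NotLinearizable.

(** * Sets of primes coding sets of natural numbers *)

Fixpoint nth_prime n : nat :=
  if n is n'.+1 then s2val (prime_above (nth_prime n')) else 2.

Lemma nth_prime_prime n : prime (nth_prime n).
Proof. by case: n => // n /=; case: prime_above. Qed.

Lemma nth_prime_inj : injective nth_prime.
Proof.
have mono : {homo nth_prime : m n / m < n}.
  by apply: (homo_ltn ltn_trans) => n /=; case: prime_above.
move=> m n mn; case: (ltngtP m n) => // /mono; by rewrite mn ltnn.
Qed.

(* Members and nonmembers of X are both recorded, so that an inclusion between two
   codes is an equality: only one direction of an isomorphism has to be examined. *)
Definition prime_code (X : set nat) : set nat :=
  [set p | exists n, (X n /\ p = nth_prime n.*2) \/ (~ X n /\ p = nth_prime n.*2.+1)].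

Lemma prime_code_separates (X Y : set nat) : X <> Y ->
  exists p, [/\ prime p, prime_code X p & ~ prime_code Y p].
Proof.
have par m n : nth_prime m.*2 = nth_prime n.*2.+1 -> False.
  by move=> /nth_prime_inj/(congr1 odd); rewrite /= !odd_double.
have dbl m n : nth_prime m.*2 = nth_prime n.*2 -> m = n by move=> /nth_prime_inj/double_inj.
have dbl1 m n : nth_prime m.*2.+1 = nth_prime n.*2.+1 -> m = n.
  by move=> /nth_prime_inj[] /double_inj.
move=> XY; apply: contrapT => H; apply: XY; apply/funext => n; apply/propext.
have {}H p : prime p -> prime_code X p -> prime_code Y p.
  by move=> pp Xp; apply: contrapT => nYp; apply: H; exists p.
split=> [Xn|Yn].
  have Xp : prime_code X (nth_prime n.*2) by exists n; left.
  by have [m [[Ym /dbl->]|[_ /par]]] := H _ (nth_prime_prime _) Xp.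
apply: contrapT => nXn.
have Xp : prime_code X (nth_prime n.*2.+1) by exists n; right.
by have [m [[_ /esym/par]|[nYm /dbl1 E]]] := H _ (nth_prime_prime _) Xp; [|apply: nYm;
  rewrite -E].
Qed.

Local Close Scope group_scope.

Theorem theorem3 (R : realType) :
  exists (I : Type) (D : I -> rgd_system),
    [/\ ~ countable [set: I],
        forall i, [/\ rgd_S (D i) !=set0, universal_type (rgd_S (D i)) &
                      ~ linearizable R (D i)] &
        forall i j, i <> j -> ~ rgd_isomorphic (D i) (D j)].
Proof.
pose s : 'I_3 := inord 0; pose t : 'I_3 := inord 1; pose u : 'I_3 := inord 2.
have [st tu su] : [/\ s != t, t != u & s != u].
  by split; apply/eqP => /(congr1 val); rewrite /= !inordK.
exists (set nat), (fun X => twisted_system st tu su (prime_code X)).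
split=> [/countable_injP[f fI]|X|X Y XY].
(* Cantor's diagonal set for an injection of [set nat] into the natural numbers. *)
- pose C := [set f X | X in [set X | ~ X (f X)]].
  have nC : ~ C (f C).
    move=> CfC; have [X nX /fI E] := CfC; apply: nX; rewrite E ?inE //.
  by apply: (nC); exists C.
- split; [by exists (letter s), s|exact: word_universal|exact: twisted_system_not_linearizable].
- have [p [pp Xp nYp]] := prime_code_separates XY.
  exact: twisted_system_not_iso pp Xp nYp.
Qed.
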